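(* Let $G$ be a connected complex Lie group. Then there exists a holomorphic map $f:\mathbb{C}\to G$ with dense image. *)

(* Defs.v *)
From HB Require Import structures.
From mathcomp Require Import all_boot all_order all_algebra.
From mathcomp Require Import complex.
From mathcomp Require Import all_classical all_reals all_analysis.

Set Implicit Arguments.
Unset Strict Implicit.
Unset Printing Implicit Defensive.

Import Order.TTheory GRing.Theory Num.Theory.
Import numFieldNormedType.Exports.

Local Open Scope classical_set_scope.
Local Open Scope complex_scope.
Local Open Scope ring_scope.

(* [differentiable] over the scalar field [R[i]] is Fréchet differentiability
   with a [R[i]]-linear differential, so on an open set [holomorphic_on] is the
   usual notion of a holomorphic map between finite-dimensional complex spaces. *)
Definition holomorphic_on (R : realType) (E F : normedModType R[i])
    (U : set E) (f : E -> F) : Prop :=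
  forall x, U x -> differentiable f x.

(* A chart of [M] modelled on [E]; [chart_map] and [chart_inv] are total
   functions, meaningful only on [chart_dom] and on its image, respectively. *)
Record chart (R : realType) (E : normedModType R[i]) (M : topologicalType) :=
  Chart {
    chart_dom : set M;
    chart_map : M -> E;
    chart_inv : E -> M
  }.

Definition chart_img (R : realType) (E : normedModType R[i])
    (M : topologicalType) (c : chart E M) : set E :=
  chart_map c @` chart_dom c.

Definition is_chart (R : realType) (E : normedModType R[i])
    (M : topologicalType) (c : chart E M) : Prop :=
  [/\ open (chart_dom c),
      open (chart_img c),
      (forall x, chart_dom c x -> chart_inv c (chart_map c x) = x),
      {within chart_dom c, continuous (chart_map c)} &
      {within chart_img c, continuous (chart_inv c)}].

Definition is_complex_atlas (R : realType) (E : normedModType R[i])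
    (M : topologicalType) (A : set (chart E M)) : Prop :=
  [/\ (forall c, A c -> is_chart c),
      (forall x, exists2 c, A c & chart_dom c x) &
      (forall c d, A c -> A d ->
         holomorphic_on (chart_map c @` (chart_dom c `&` chart_dom d))
                        (chart_map d \o chart_inv c))].

Definition holomorphic_map (R : realType) (E F : normedModType R[i])
    (M N : topologicalType) (A : set (chart E M)) (B : set (chart F N))
    (f : M -> N) : Prop :=
  continuous f /\
  forall c d, A c -> B d ->
    holomorphic_on (chart_map c @` (chart_dom c `&` f @^-1` chart_dom d))
                   (chart_map d \o f \o chart_inv c).

Definition model_atlas (R : realType) (E : normedModType R[i]) :
    set (chart E E) :=
  [set Chart [set: E] id id].
Arguments model_atlas {R} E.

Definition prod_chart (R : realType) (E F : normedModType R[i])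
    (M N : topologicalType) (c : chart E M) (d : chart F N) :
    chart (E * F)%type (M * N)%type :=
  Chart (chart_dom c `*` chart_dom d)
        (fun p => (chart_map c p.1, chart_map d p.2))
        (fun q => (chart_inv c q.1, chart_inv d q.2)).

Definition prod_atlas (R : realType) (E F : normedModType R[i])
    (M N : topologicalType) (A : set (chart E M)) (B : set (chart F N)) :
    set (chart (E * F)%type (M * N)%type) :=
  [set prod_chart c d | c in A & d in B].

HB.mixin Record isComplexManifold (R : realType) (n : nat) M
    of Topological M := {
  atlas : set (chart 'rV[R[i]]_n M);
  atlasP : is_complex_atlas atlas;
  manifold_hausdorff : hausdorff_space M;
  manifold_second_countable : @second_countable M
}.

#[short(type="complexManifoldType")]
HB.structure Definition ComplexManifold (R : realType) (n : nat) :=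
  {M of Topological M & isComplexManifold R n M}.

HB.mixin Record isComplexLieGroup (R : realType) (n : nat) G
    of Group G & ComplexManifold R n G := {
  holomorphic_mulg : holomorphic_map
    (prod_atlas (@atlas R n G) (@atlas R n G)) (@atlas R n G)
    (fun p : G * G => (p.1 * p.2)%g);
  holomorphic_invg : holomorphic_map (@atlas R n G) (@atlas R n G)
    (fun x : G => x^-1%g)
}.

#[short(type="complexLieGroupType")]
HB.structure Definition ComplexLieGroup (R : realType) (n : nat) :=
  {G of Group G & ComplexManifold R n G & isComplexLieGroup R n G}.

(* Main.v *)
(** The curve is an infinite product [f = p_0 p_1 p_2 ...] of entire maps into
    [G]: [p_k] is close to 1 on the disc of radius [k], and at the point [k + 1]
    it moves the partial product into the [k]-th set of a countable base.  Such
    a [p_k] is [F ((z / (k + 1)) ^ N)] with [N] large and [F] entire, [F 0 = 1].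

    The values [F 1] form a dense set.  Read in a chart at 1, squaring is a map
    [s x = 2 x + O(|x|^2)], so [Phi = lim s^k (x / 2^k)] conjugates doubling to
    squaring, and [Phi (2 x) = s (Phi x)] extends each [z |-> Phi (z v)] to an
    entire curve in [G].  As [Phi x = x + O(|x|^2)], every [y] near 1 is a limit
    of products of values of such curves (Newton iteration), and a closed
    submonoid containing a neighbourhood of 1 is all of the connected group [G].

    Holomorphy being mere complex differentiability, these limits rest on
    Cauchy's estimate, obtained from Goursat's subdivision argument carried out
    on midpoint Riemann sums.  Applying it to difference quotients gives a
    uniform second order Taylor bound, hence differentiability of bounded
    pointwise limits. *)

From HB Require Import structures.
Require Import Defs.
From mathcomp Require Import all_boot all_order all_algebra.
From mathcomp Require Import complex.
From mathcomp Require Import all_classical all_reals all_analysis.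
From mathcomp Require Import ring lra.
Import numFieldNormedType.Exports.
Import Order.TTheory GRing.Theory Num.Theory.
Local Open Scope classical_set_scope.
Local Open Scope complex_scope.
Local Open Scope ring_scope.

Set Implicit Arguments.
Unset Strict Implicit.
Unset Printing Implicit Defensive.

(** * Real-valued norms over the complex numbers *)

(** The function theory needs only inequalities, never the value of an integral. The Riemann sums
    are not shown to converge; bounds valid for all fine enough subdivisions suffice, and the
    winding number is merely bounded below by 4. This costs a constant in Cauchy's estimate but
    spares logarithms, [pi] and integration of vector-valued functions. Likewise the exponential is
    built without vector fields, and no inverse function theorem is invoked: since only density is
    wanted, approximate factorisation of points near 1 replaces local surjectivity. In the infinite
    product the order of choices is decisive. The factor [p_k] is fixed first; the tolerance for all
    later factors is chosen afterwards, so small that their product, read in the chart at 1, cannot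
    push the value at [k + 1] out of the open set just reached. The tails are estimated on discs,
    where they stay inside that chart, so no invariant distance on [G] is used. *)

Section RealNorm.
Context {R : realType}.
Local Notation C := (R[i]).
Implicit Types E F : normedModType C.

(** Norms over [R[i]] are themselves complex numbers, which are only partially ordered; their real
    part lives in [R], where linear arithmetic and the archimedean property apply. *)
Definition rnorm E (x : E) : R := complex.Re `|x|.

Lemma rnormE E (x : E) : `|x| = (rnorm x)%:C.
Proof.
rewrite /rnorm; have := normr_ge0 x; case: (`|x|) => a b.
by rewrite lecE /= => /andP[/eqP -> _].
Qed.

Lemma rnorm_ge0 E (x : E) : 0 <= rnorm x.
Proof. by have := normr_ge0 x; rewrite rnormE lecR. Qed.

Lemma rnorm0 E : rnorm (0 : E) = 0.
Proof. by rewrite /rnorm normr0. Qed.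

Lemma rnorm_eq0 E (x : E) : rnorm x = 0 -> x = 0.
Proof. by move=> x0; apply/eqP; rewrite -normr_eq0 rnormE x0. Qed.

Lemma rnorm_le0 E (x : E) : rnorm x <= 0 -> x = 0.
Proof.
by move=> h; apply: rnorm_eq0; apply/eqP; rewrite eq_le h rnorm_ge0.
Qed.

Lemma rnormN E (x : E) : rnorm (- x) = rnorm x.
Proof. by rewrite /rnorm normrN. Qed.

Lemma rnormBC E (x y : E) : rnorm (x - y) = rnorm (y - x).
Proof. by rewrite -rnormN opprB. Qed.

Lemma rnormD E (x y : E) : rnorm (x + y) <= rnorm x + rnorm y.
Proof. by have := ler_normD x y; rewrite !rnormE -rmorphD lecR. Qed.

Lemma rnormB E (x y : E) : rnorm (x - y) <= rnorm x + rnorm y.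
Proof. by rewrite -(rnormN y) rnormD. Qed.

Lemma rnorm_subD E (y x z : E) : rnorm (x - z) <= rnorm (x - y) + rnorm (y - z).
Proof. by have := rnormD (x - y) (y - z); rewrite addrA subrK. Qed.

Lemma rnormZ E (a : C) (x : E) : rnorm (a *: x) = rnorm (a : C^o) * rnorm x.
Proof.
have := normrZ a x; rewrite !rnormE [`|a|](rnormE (a : C^o)) -rmorphM.
by move=> /(congr1 (@complex.Re R)).
Qed.

Lemma rnorm_sum E (I : Type) (r : seq I) (P : pred I) (f : I -> E) :
  rnorm (\sum_(i <- r | P i) f i) <= \sum_(i <- r | P i) rnorm (f i).
Proof.
elim/big_ind2 : _ => //; first by rewrite rnorm0.
by move=> x a y b xa yb; apply: (le_trans (rnormD _ _)); exact: lerD.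
Qed.

Lemma rnorm_real (a : R) : rnorm (a%:C : C^o) = `|a|.
Proof. by rewrite /rnorm normc_def /= expr0n /= addr0 sqrtr_sqr. Qed.

Lemma rnormM (a b : C) : rnorm (a * b : C^o) = rnorm (a : C^o) * rnorm (b : C^o).
Proof. exact: (rnormZ a (b : C^o)). Qed.

Lemma rnorm1 : rnorm (1 : C^o) = 1.
Proof. by rewrite /rnorm normr1. Qed.

Lemma rnormV (a : C) : rnorm (a^-1 : C^o) = (rnorm (a : C^o))^-1.
Proof.
have [->|a0] := eqVneq a 0; first by rewrite invr0 rnorm0 invr0.
have na0 : rnorm (a : C^o) != 0 by apply: contra a0 => /eqP/rnorm_eq0 ->.
by apply: (mulfI na0); rewrite -rnormM !mulfV // rnorm1.
Qed.

Lemma rnormX (a : C) n : rnorm (a ^+ n : C^o) = rnorm (a : C^o) ^+ n.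
Proof. by elim: n => [|n ih]; rewrite ?expr0 ?rnorm1 // !exprS rnormM ih. Qed.

Lemma rnorm_gt0 E (x : E) : x != 0 -> 0 < rnorm x.
Proof.
move=> x0; rewrite lt_neqAle rnorm_ge0 andbT eq_sym.
by apply: contra x0 => /eqP/rnorm_eq0 ->.
Qed.

Lemma rnorm_Re (a : C) : `|complex.Re a| <= rnorm (a : C^o).
Proof.
rewrite /rnorm normc_def; case: a => a b /=.
rewrite -sqrtr_sqr ler_sqrt ?lerDl ?sqr_ge0 //.
by rewrite addr_ge0 // sqr_ge0.
Qed.

Lemma rnorm_Im (a : C) : `|complex.Im a| <= rnorm (a : C^o).
Proof.
rewrite /rnorm normc_def; case: a => a b /=.
rewrite -sqrtr_sqr ler_sqrt ?lerDr ?sqr_ge0 //.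
by rewrite addr_ge0 // sqr_ge0.
Qed.

Lemma rnorm_i : rnorm ('i%C : C^o) = 1.
Proof. by rewrite /rnorm normc_def /= expr0n add0r expr1n sqrtr1. Qed.

Lemma rnorm_ReIm (a : C) :
  rnorm (a : C^o) <= `|complex.Re a| + `|complex.Im a|.
Proof.
have -> : a = (complex.Re a)%:C + 'i%C * (complex.Im a)%:C.
  by case: a => a b; simpc.
apply: (le_trans (rnormD (_ : C^o) (_ : C^o))).
rewrite rnormM rnorm_i !rnorm_real mul1r.
by rewrite /= !mul0r !mul1r ?mulr0 ?subr0 ?addr0 ?add0r.
Qed.

Lemma nbhs_rnormP E (x : E) (A : set E) :
  nbhs x A <-> exists2 e : R, 0 < e & forall y, rnorm (y - x) < e -> A y.
Proof.
apply: (iff_trans (nbhs_normP _ _)); split => [[e /= e0 eA]|[e e0 eA]].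
  (* The order on [R[i]] compares only numbers with equal imaginary parts, so a positive radius is
     real. *)
  have eE : e = (complex.Re e)%:C.
    by move: e0; case: (e) => a b; rewrite ltcE /= => /andP[/eqP ->].
  exists (complex.Re e); first by rewrite eE ltcR in e0.
  by move=> y yx; apply: eA; rewrite /= eE distrC rnormE ltcR.
exists e%:C; first by rewrite /= ltcR.
by move=> y /=; rewrite distrC rnormE ltcR => /eA.
Qed.

Lemma differentiable_rnormP E F (f : E -> F) (x : E) :
  differentiable f x <->
  exists2 L : {linear E -> F}, continuous L &
  forall e : R, 0 < e -> exists2 d : R, 0 < d & forall y, rnorm (y - x) < d ->
    rnorm (f y - f x - L (y - x)) <= e * rnorm (y - x).
Proof.
split.
  move=> /diff_locallyP[dfc /eqaddoP df]; exists ('d f x) => //.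
  move=> e e0.
  have ec0 : 0 < e%:C by rewrite ltcR.
  move: df => /(_ _ ec0) /nbhs_rnormP[d d0 dP]; exists d => // y yx.
  have := dP (y - x); rewrite subr0 => /(_ yx).
  by rewrite !fctE /= subrK opprD addrA !rnormE -rmorphM lecR.
move=> [L Lc fL]; apply/diff_locallyP.
have Ld : f \o shift x = cst (f x) + L +o_ 0 id.
  apply/eqaddoP => e e0.
  have eE : e = (complex.Re e)%:C.
    by move: e0; case: (e) => a b; rewrite ltcE /= => /andP[/eqP ->].
  have [|d d0 dP] := fL (complex.Re e); first by rewrite eE ltcR in e0.
  apply/nbhs_rnormP; exists d => // y; rewrite subr0 => yd.
  have := dP (y + x); rewrite addrK => /(_ yd).
  by rewrite !fctE /= opprD addrA !rnormE eE -rmorphM lecR.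
by rewrite (diff_unique Lc Ld).
Qed.

End RealNorm.

(** * Riemann sums along rectangles *)

Section OneVariable.
Context {R : realType}.
Local Notation C := (R[i]).
Implicit Types F : normedModType C.

(** An [R[i]]-linear differential on [C^o] is determined by its value at 1, so a vector [L] of [F]
    stands for it. *)
Definition cderiv F (g : C^o -> F) (z : C^o) (L : F) : Prop :=
  forall e : R, 0 < e -> exists2 d : R, 0 < d & forall y : C^o,
    rnorm (y - z) < d -> rnorm (g y - g z - (y - z) *: L) <= e * rnorm (y - z).

Definition scalel F (L : F) (h : C^o) : F := (h : C) *: L.

Lemma scalel_is_linear F (L : F) : linear (scalel L).
Proof. by move=> a x y; rewrite /scalel scalerDl scalerA. Qed.

HB.instance Definition _ F (L : F) :=
  GRing.isLinear.Build C C^o F *:%R (scalel L) (scalel_is_linear L).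

Lemma differentiable_cderivP F (g : C^o -> F) (z : C^o) :
  differentiable g z <-> exists L, cderiv g z L.
Proof.
split=> [/differentiable_rnormP[L _ dg]|[L dg]].
  exists (L 1) => e /dg[d d0 dP]; exists d => // y /dP.
  by rewrite -[in L _](mulr1 (y - z)) linearZ.
apply/differentiable_rnormP; exists (scalel L).
  exact: scalel_continuous.
by move=> e /dg.
Qed.

Lemma ReD (x y : C) : complex.Re (x + y) = complex.Re x + complex.Re y.
Proof. by case: x y => a b [c d]. Qed.
Lemma ImD (x y : C) : complex.Im (x + y) = complex.Im x + complex.Im y.
Proof. by case: x y => a b [c d]. Qed.
Lemma ReN (x : C) : complex.Re (- x) = - complex.Re x.
Proof. by case: x. Qed.
Lemma ImN (x : C) : complex.Im (- x) = - complex.Im x.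
Proof. by case: x. Qed.
Lemma ReM (x y : C) : complex.Re (x * y) =
  complex.Re x * complex.Re y - complex.Im x * complex.Im y.
Proof. by case: x y => a b [c d]. Qed.
Lemma ImM (x y : C) : complex.Im (x * y) =
  complex.Re x * complex.Im y + complex.Im x * complex.Re y.
Proof. by case: x y => a b [c d]. Qed.

Definition reimE := (ReD, ImD, ReN, ImN, ReM, ImM).

Lemma complex_inj (x y : C) :
  complex.Re x = complex.Re y -> complex.Im x = complex.Im y -> x = y.
Proof. by case: x y => a b [c d] /= -> ->. Qed.

(** The supremum of the left endpoints works, because monotonicity puts every left endpoint below
    every right one. *)
Lemma nested_reals (a b : nat -> R) :
  (forall n, a n <= a n.+1) -> (forall n, b n.+1 <= b n) ->
  (forall n, a n <= b n) -> exists x, forall n, a n <= x <= b n.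
Proof.
move=> a_incr b_decr ab.
have mono m n : (m <= n)%N -> a m <= a n.
  by apply: (homo_leq (fun x => lexx x) (fun x y z => @le_trans _ _ x y z) a_incr).
have monb m n : (m <= n)%N -> b n <= b m.
  have := @homo_leq _ b (fun x y => y <= x) (fun x => lexx x)
    (fun x y z h1 h2 => @le_trans _ _ x z y h2 h1) b_decr m n.
  by [].
have ub m n : a m <= b n.
  have [mn|nm] := leqP m n; first exact: le_trans (mono _ _ mn) (ab n).
  by apply: le_trans (ab m) _; apply: monb; exact: ltnW.
have sA : has_sup (range a).
  by split; [exists (a 0%N), 0%N|exists (b 0%N) => _ [m _ <-]].
exists (sup (range a)) => n; apply/andP; split.
  by apply: sup_upper_bound => //; exists n.
by apply: ge_sup; [case: sA|move=> _ [m _ <-]].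
Qed.

(* Midpoint Riemann sums with [n] nodes, from [a] to [a + n h]. *)
Definition segsum F (g : C^o -> F) n (a h : C) : F :=
  \sum_(j < n) h *: g (a + h * (j%:R + 2^-1)).

(** Counterclockwise contour sum, bottom minus top and then right minus left, with one node per cell
    edge. It stands in for the contour integral. *)
Definition rectsum F (g : C^o -> F) m n (a h : C) : F :=
  (segsum g m a h - segsum g m (a + h * 'i%C * n%:R) h)
  + (segsum g n (a + h * m%:R) (h * 'i%C) - segsum g n a (h * 'i%C)).

Lemma segsumD F (g : C^o -> F) m n a h :
  segsum g (m + n) a h = segsum g m a h + segsum g n (a + h * m%:R) h.
Proof.
rewrite /segsum big_split_ord; congr (_ + _) => /=.
by apply: eq_bigr => j _; rewrite natrD; congr (_ *: g _); ring.
Qed.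

(** The common vertical side is sampled at the same nodes from both rectangles and cancels
    exactly. *)
Lemma rectsumDl F (g : C^o -> F) m1 m2 n a h :
  rectsum g (m1 + m2) n a h = rectsum g m1 n a h + rectsum g m2 n (a + h * m1%:R) h.
Proof.
rewrite /rectsum !segsumD !natrD.
have -> : a + h * 'i%C * n%:R + h * m1%:R = a + h * m1%:R + h * 'i%C * n%:R by ring.
have -> : a + h * (m1%:R + m2%:R) = a + h * m1%:R + h * m2%:R by ring.
set A := segsum g m1 a h; set B := segsum g m2 _ h; set C' := segsum g m1 _ h.
set D := segsum g m2 _ h; set V3 := segsum g n (_ + _ + _) _; set V1 := segsum g n a _.
set V2 := segsum g n _ _.
rewrite opprD !addrA; rewrite [RHS](AC (8) ((1*5)*(2*6)*7*4*(3*8)))/=.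
by rewrite subrr addr0 [A + B - C' - D](AC 4 ((1*2)*(3*4)))/= !addrA.
Qed.


Lemma rectsumDr F (g : C^o -> F) m n1 n2 a h :
  rectsum g m (n1 + n2) a h =
  rectsum g m n1 a h + rectsum g m n2 (a + h * 'i%C * n1%:R) h.
Proof.
rewrite /rectsum !segsumD !natrD.
have -> : a + h * m%:R + h * 'i%C * n1%:R = a + h * 'i%C * n1%:R + h * m%:R by ring.
have -> : a + h * 'i%C * (n1%:R + n2%:R) =
  a + h * 'i%C * n1%:R + h * 'i%C * n2%:R by ring.
set A := segsum g m a h; set B := segsum g m _ h; set D := segsum g m _ h.
set V1 := segsum g n1 _ _; set V2 := segsum g n2 _ _.
set V3 := segsum g n1 _ _; set V4 := segsum g n2 _ _.
rewrite opprD !addrA [RHS](AC (8) (1*6*3*7*4*8*(2*5)))/=.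
by rewrite addNr addr0.
Qed.

(** The midpoint rule is exact on affine integrands, whose integral around a closed contour
    vanishes. *)
Lemma rectsum_cell_affine F (A L : F) (z0 a h : C) :
  rectsum (fun z => A + (z - z0) *: L) 1 1 a h = 0.
Proof.
rewrite /rectsum /segsum !big_ord1 /= !scalerDr !scalerA.
rewrite !opprD !addrA.
rewrite (AC 8 ((1*3)*(5*7)*((2*4)*(6*8))))/= !subrr !add0r -!scaleNr -!scalerDl.
set k := (X in X *: L); have -> : k = 0 by rewrite /k !scaleNr /GRing.scale /=; ring.
by rewrite scale0r.
Qed.

Lemma rectsum_affine F (A L : F) (z0 : C) m n a h :
  rectsum (fun z => A + (z - z0) *: L) m n a h = 0.
Proof.
have rect0n (g : C^o -> F) k b : rectsum g 0 k b h = 0.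
  by rewrite /rectsum /segsum !big_ord0 !subr0 mulr0 addr0 subrr addr0.
have rectn0 (g : C^o -> F) k b : rectsum g k 0 b h = 0.
  by rewrite /rectsum /segsum !big_ord0 mulr0 addr0 !subrr addr0.
elim: m a => [|m ihm] a //; rewrite -[m.+1]addn1 rectsumDl ihm add0r.
move: (a + _) => {}a {ihm}; elim: n a => [|n ihn] a //.
by rewrite -[n.+1]addn1 rectsumDr ihn add0r rectsum_cell_affine.
Qed.

Lemma rectsumB F (g1 g2 : C^o -> F) m n a h :
  rectsum (fun z => g1 z - g2 z) m n a h = rectsum g1 m n a h - rectsum g2 m n a h.
Proof.
have segB k b l : segsum (fun z => g1 z - g2 z) k b l = segsum g1 k b l - segsum g2 k b l.
  by rewrite /segsum -sumrB; apply: eq_bigr => j _; rewrite scalerBr.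
rewrite /rectsum !segB !opprD !opprK !addrA.
by rewrite (AC 8 (1*3*5*7*(2*4*6*8)))/= !addrA.
Qed.

(* The sample points of [rectsum] lie on the boundary of the rectangle. *)
Definition on_rect m n (a h z : C) : Prop :=
  exists2 t : R, 0 <= t <= 1 &
  [\/ z = a + h * (t * m%:R)%:C, z = a + h * (t * m%:R)%:C + h * 'i%C * n%:R,
      z = a + h * 'i%C * (t * n%:R)%:C | z = a + h * 'i%C * (t * n%:R)%:C + h * m%:R].

Lemma midpoint_ratio n (j : 'I_n) :
  exists2 t : R, 0 <= t <= 1 & (j%:R + 2^-1 : C) = (t * n%:R)%:C.
Proof.
case: n j => [[] //|n] j.
exists ((j%:R + 2^-1) / n.+1%:R).
  rewrite divr_ge0 ?addr_ge0 //= ler_pdivrMr ?ltr0n // mul1r.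
  have : (j.+1%:R : R) <= n.+1%:R by rewrite ler_nat ltn_ord.
  by rewrite -natr1; lra.
rewrite divfK ?pnatr_eq0 // rmorphD rmorphV ?unitfE ?pnatr_eq0 //.
by rewrite !rmorph_nat.
Qed.

(** The contour has [2 * (m + n)] nodes, each weighted by a number of norm [rnorm h]. *)
Lemma rectsum_bound F (g : C^o -> F) m n (a h : C) M :
  (forall z, on_rect m n a h z -> rnorm (g z) <= M) ->
  rnorm (rectsum g m n a h) <= (m + n)%:R * 2 * rnorm (h : C^o) * M.
Proof.
move=> gM.
have segM k b l : (forall j : 'I_k, rnorm (g (b + l * (j%:R + 2^-1))) <= M) ->
    rnorm (l : C^o) = rnorm (h : C^o) ->
    rnorm (segsum g k b l) <= k%:R * (rnorm (h : C^o) * M).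
  move=> gk lh; apply: (le_trans (rnorm_sum _ _ _)).
  have -> : k%:R * (rnorm (h : C^o) * M) = \sum_(j < k) (rnorm (h : C^o) * M).
    by rewrite sumr_const card_ord mulr_natl.
  by apply: ler_sum => j _; rewrite rnormZ lh ler_wpM2l // rnorm_ge0.
have hi : rnorm (h * 'i%C : C^o) = rnorm (h : C^o) by rewrite rnormM rnorm_i mulr1.
have -> : (m + n)%:R * 2 * rnorm (h : C^o) * M =
  (m%:R * (rnorm (h : C^o) * M) + m%:R * (rnorm (h : C^o) * M)) +
  (n%:R * (rnorm (h : C^o) * M) + n%:R * (rnorm (h : C^o) * M)) :> R.
  by rewrite natrD; ring.
rewrite /rectsum.
apply: le_trans (rnormD _ _) (lerD _ _); apply: le_trans (rnormB _ _) (lerD _ _).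
- apply: segM => // j; apply: gM; have [t t01 ->] := midpoint_ratio j.
  by exists t => //; apply: Or41.
- apply: segM => // j; apply: gM; have [t t01 ->] := midpoint_ratio j.
  by exists t => //; apply: Or42; ring.
- apply: segM => // j; apply: gM; have [t t01 ->] := midpoint_ratio j.
  by exists t => //; apply: Or44; ring.
- apply: segM => // j; apply: gM; have [t t01 ->] := midpoint_ratio j.
  by exists t => //; apply: Or43.
Qed.


(* With [3 ^ k] nodes per side the sums are exactly additive under subdivision
   into nine squares, the middle one of which keeps the centre of the square. *)
Definition sqsum F (g : C^o -> F) k (a : C) (s : R) : F :=
  rectsum g (3 ^ k) (3 ^ k) a (s / 3 ^+ k)%:C.

Definition subcorner (a : C) (s : R) (u v : 'I_3) : C :=
  a + (s / 3)%:C * u%:R + (s / 3)%:C * 'i%C * v%:R.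

Lemma sqsumS F (g : C^o -> F) k a s :
  sqsum g k.+1 a s =
  \sum_(u < 3) \sum_(v < 3) sqsum g k (subcorner a s u v) (s / 3).
Proof.
rewrite /sqsum.
have -> : s / 3 / 3 ^+ k = s / 3 ^+ k.+1 by rewrite exprS invfM mulrA.
set h := (s / 3 ^+ k.+1)%:C; have hE : (s / 3)%:C = h * (3 ^ k)%:R.
  rewrite /h -(rmorph_nat (real_complex R)) -rmorphM natrX exprS invfM mulrA.
  by rewrite divfK // expf_neq0 // pnatr_eq0.
have colE b : rectsum g (3 ^ k) (3 ^ k.+1) b h =
    \sum_(v < 3) rectsum g (3 ^ k) (3 ^ k) (b + (s / 3)%:C * 'i%C * v%:R) h.
  rewrite !big_ord_recl big_ord0 addr0 expnS mulSn mul2n -addnn.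
  rewrite rectsumDr rectsumDr; congr (rectsum _ _ _ _ _ + (rectsum _ _ _ _ _ + rectsum _ _ _ _ _)).
  - by rewrite mulr0 addr0.
  - by rewrite -[nat_of_ord _]/1%N hE; ring.
  - by rewrite -[nat_of_ord _]/2%N hE; ring.
have -> : (3 ^ k.+1)%N = (3 ^ k + (3 ^ k + 3 ^ k))%N.
  by rewrite expnS mulSn mul2n -addnn.
(* Only the horizontal count is split; the vertical one is folded back to the form that [colE]
   expects. *)
rewrite [in X in rectsum g _ X](_ : (3 ^ k + (3 ^ k + 3 ^ k))%N = (3 ^ k.+1)%N);
  last by rewrite expnS mulSn mul2n -addnn.
rewrite !rectsumDl !colE [RHS]big_ord_recl big_ord_recl big_ord_recl big_ord0 addr0.
congr (_ + (_ + _)); apply: eq_bigr => v _; rewrite /subcorner; congr rectsum.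
- by rewrite mulr0 addr0.
- by rewrite -[nat_of_ord (lift ord0 ord0)]/1%N hE; ring.
- by rewrite -[nat_of_ord (lift ord0 (lift ord0 ord0))]/2%N hE; ring.
Qed.

Definition box (a : C) (s : R) (z : C) : Prop :=
  0 <= complex.Re (z - a) <= s /\ 0 <= complex.Im (z - a) <= s.

Lemma boxE (a : C) (s : R) z : box a s z <->
  [/\ complex.Re a <= complex.Re z, complex.Im a <= complex.Im z,
      complex.Re z <= complex.Re a + s & complex.Im z <= complex.Im a + s].
Proof.
rewrite /box !reimE !subr_ge0 !lerBlDl.
by split=> [[/andP[-> ->] /andP[-> ->]]|[-> -> -> ->]].
Qed.

Lemma on_rect_square k (a : C) (s : R) z : 0 <= s ->
  on_rect (3 ^ k) (3 ^ k) a (s / 3 ^+ k)%:C z ->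
  exists2 t : R, 0 <= t <= 1 &
  [\/ z = a + (t * s)%:C, z = a + (t * s)%:C + (s *i)%C,
      z = a + ((t * s) *i)%C | z = a + ((t * s) *i)%C + s%:C].
Proof.
move=> s0 [t t01 zt]; exists t => //.
have E : (s / 3 ^+ k)%:C * (3 ^ k)%:R = s%:C.
  rewrite -(rmorph_nat (real_complex R)) -rmorphM natrX divfK //.
have Et : (s / 3 ^+ k)%:C * (t * (3 ^ k)%:R)%:C = (t * s)%:C.
  have -> : (t * (3 ^ k)%:R)%:C = (3 ^ k)%:R * t%:C :> C.
    by rewrite mulrC rmorphM rmorph_nat.
  by rewrite mulrA E -rmorphM mulrC.
have I x : x%:C * 'i%C = (x *i)%C by simpc.
case: zt => ->.
- by apply: Or41; rewrite Et.
- by apply: Or42; rewrite Et mulrAC E I.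
- by apply: Or43; rewrite mulrAC Et I.
- by apply: Or44; rewrite mulrAC Et I E.
Qed.

Lemma on_rect_box k (a : C) (s : R) z : 0 <= s ->
  on_rect (3 ^ k) (3 ^ k) a (s / 3 ^+ k)%:C z -> box a s z.
Proof.
move=> s0 /(on_rect_square s0)[t /andP[t0 t1] H].
have ts0 : 0 <= t * s by rewrite mulr_ge0.
have ts1 : t * s <= s by rewrite ler_piMl.
by apply/boxE; case: H => ->; rewrite !reimE /= !addr0; split; lra.
Qed.

Lemma box_diam a s z w : box a s z -> box a s w -> rnorm (z - w : C^o) <= 2 * s.
Proof.
move=> [/andP[z1 z2] /andP[z3 z4]] [/andP[w1 w2] /andP[w3 w4]].
apply: le_trans (rnorm_ReIm _) _.
move: z1 z2 z3 z4 w1 w2 w3 w4; rewrite !reimE => *.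
have : `|complex.Re z - complex.Re w| <= s by rewrite ler_norml; apply/andP; split; lra.
have : `|complex.Im z - complex.Im w| <= s by rewrite ler_norml; apply/andP; split; lra.
by lra.
Qed.

(** Asymptotic bound replacing an estimate of the contour integral: the sums [sqsum g k a s] need
    not be known to converge. *)
Definition sqsum_le F (g : C^o -> F) (a : C) (s B : R) : Prop :=
  exists K, forall k, (K <= k)%N -> rnorm (sqsum g k a s) <= B.

Lemma sqsum_le_sub F (g : C^o -> F) a s (B : 'I_3 -> 'I_3 -> R) :
  (forall u v, sqsum_le g (subcorner a s u v) (s / 3) (B u v)) ->
  sqsum_le g a s (\sum_(u < 3) \sum_(v < 3) B u v).
Proof.
move=> H; have /choice[K KP] : forall uv : 'I_3 * 'I_3, exists K, forall k, (K <= k)%N ->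
    rnorm (sqsum g k (subcorner a s uv.1 uv.2) (s / 3)) <= B uv.1 uv.2.
  by move=> [u v]; exact: H.
(* The sum of the nine thresholds is a common upper bound for them; the successor pays for the level
   lost in [sqsumS]. *)
exists (\sum_(uv : 'I_3 * 'I_3) K uv).+1 => -[//|k]; rewrite ltnS => Kk; rewrite sqsumS.
apply: le_trans (rnorm_sum _ _ _) _; apply: ler_sum => u _.
apply: le_trans (rnorm_sum _ _ _) _; apply: ler_sum => v _.
apply: (KP (u, v)); apply: leq_trans Kk.
by rewrite (bigD1 (u, v)) //= leq_addr.
Qed.

End OneVariable.

(** * Goursat's theorem *)

Section Goursat.
Context {R : realType}.
Local Notation C := (R[i]).
Implicit Types F : normedModType C.

Lemma Re_subcorner (a : C) (s : R) (u v : 'I_3) :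
  complex.Re (subcorner a s u v) = complex.Re a + s / 3 * u%:R.
Proof.
rewrite /subcorner -(rmorph_nat (real_complex R) u) -(rmorph_nat (real_complex R) v).
by rewrite !reimE /= !mulr0 !mul0r !subr0 !mul0r !addr0.
Qed.

Lemma Im_subcorner (a : C) (s : R) (u v : 'I_3) :
  complex.Im (subcorner a s u v) = complex.Im a + s / 3 * v%:R.
Proof.
rewrite /subcorner -(rmorph_nat (real_complex R) u) -(rmorph_nat (real_complex R) v).
by rewrite !reimE /= !mulr0 !mul0r !add0r !addr0 mulr1.
Qed.

Lemma third_bounds (s : R) (u : 'I_3) : 0 <= s ->
  0 <= s / 3 * u%:R /\ s / 3 * u%:R + s / 3 <= s.
Proof.
move=> s0; have s30 : 0 <= s / 3 by rewrite divr_ge0.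
split; first by rewrite mulr_ge0.
have : s / 3 * u%:R <= s / 3 * 2.
  by apply: ler_wpM2l => //; rewrite ler_nat -ltnS ltn_ord.
by move: (s / 3 * u%:R) => x; lra.
Qed.

Lemma subcorner_monotone (a : C) (s : R) (u v : 'I_3) : 0 <= s ->
  let b := subcorner a s u v in
  [/\ complex.Re a <= complex.Re b, complex.Im a <= complex.Im b,
      complex.Re b + s / 3 <= complex.Re a + s &
      complex.Im b + s / 3 <= complex.Im a + s].
Proof.
move=> s0 /=; rewrite Re_subcorner Im_subcorner.
have [u0 u1] := third_bounds u s0; have [v0 v1] := third_bounds v s0.
by rewrite !lerDl -!addrA !lerD2l.
Qed.

Lemma subcorner_box (a : C) (s : R) (u v : 'I_3) z : 0 <= s ->
  box (subcorner a s u v) (s / 3) z -> box a s z.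
Proof.
move=> s0; have [h1 h2 h3 h4] := subcorner_monotone a u v s0.
move=> /boxE[z1 z2 z3 z4]; apply/boxE; split.
- exact: le_trans z1.
- exact: le_trans z2.
- exact: le_trans h3.
- exact: le_trans h4.
Qed.

(** Subtracting an affine function changes no sum, and what remains is at most [e] on a contour of
    length [4 * s]. *)
Lemma sqsum_le_affine F (g : C^o -> F) (a : C) (s e : R) (z0 : C^o) L : 0 <= s -> 
  (forall z, box a s z -> rnorm (g z - g z0 - (z - z0) *: L) <= e) ->
  sqsum_le g a s (4 * s * e).
Proof.
move=> s0 H; exists 0%N => k _; rewrite /sqsum.
have -> : rectsum g (3 ^ k) (3 ^ k) a (s / 3 ^+ k)%:C =
   rectsum (fun z => g z - (g z0 + (z - z0) *: L)) (3 ^ k) (3 ^ k) a (s / 3 ^+ k)%:C.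
  by rewrite rectsumB rectsum_affine subr0.
apply: (@le_trans _ _ ((3 ^ k + 3 ^ k)%:R * 2 * rnorm ((s / 3 ^+ k)%:C : C^o) * e)).
  apply: rectsum_bound => z /(on_rect_box s0) /H.
  by rewrite opprD addrA.
rewrite rnorm_real ger0_norm ?divr_ge0 ?exprn_ge0 //.
rewrite natrD natrX le_eqVlt; apply/orP; left; apply/eqP.
by field; rewrite expf_neq0.
Qed.

Lemma cderiv_sqsum_le F (g : C^o -> F) (z : C^o) L (eta : R) : cderiv g z L ->
  0 < eta -> exists2 d : R, 0 < d & forall a s, 0 < s < d -> box a s z ->
  sqsum_le g a s (eta * s ^+ 2).
Proof.
move=> gL eta0; have e0 : 0 < eta / 8 by rewrite divr_gt0.
have [d d0 dP] := gL _ e0.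
exists (d / 2) => [|a s /andP[s0 sd] az]; first by rewrite divr_gt0.
(* The error is [eta / 8] times a distance of at most [2 * s], over a perimeter [4 * s]. *)
have -> : eta * s ^+ 2 = 4 * s * (eta / 8 * (2 * s)) by field.
apply: (sqsum_le_affine (z0 := z) (L := L)) => [|y ay]; first exact: ltW.
have yz := box_diam ay az.
have /dP h : rnorm (y - z : C^o) < d by lra.
by apply: le_trans h _; rewrite ler_wpM2l // ltW.
Qed.

(** If a bound proportional to the area fails on a square, it fails on one of its nine parts. The
    resulting nested squares shrink to a point at which [cderiv_sqsum_le] contradicts the
    failure. *)
Theorem goursat F (g : C^o -> F) (a : C) (s : R) : 0 < s ->
  (forall z, box a s z -> exists L, cderiv g z L) ->
  forall eta, 0 < eta -> sqsum_le g a s eta.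
Proof.
move=> s0 gd eta0 eta0_gt0.
pose eta := eta0 / s ^+ 2.
have eta_gt0 : 0 < eta by rewrite divr_gt0 ?exprn_gt0.
have -> : eta0 = eta * s ^+ 2 by rewrite divfK // expf_neq0 // gt_eqF.
have [//|bad] := pselect (sqsum_le g a s (eta * s ^+ 2)).
have step (b : C) (t : R) : ~ sqsum_le g b t (eta * t ^+ 2) ->
    exists uv : 'I_3 * 'I_3, ~ sqsum_le g (subcorner b t uv.1 uv.2) (t / 3) (eta * (t / 3) ^+ 2).
  move=> bbad; apply: contrapT => /forallNP H; apply: bbad.
  have -> : eta * t ^+ 2 = \sum_(u < 3) \sum_(v < 3) (eta * (t / 3) ^+ 2).
    by rewrite !sumr_const !card_ord -mulrnA -[RHS]mulr_natl; field.
  by apply: sqsum_le_sub => u v; have /contrapT := H (u, v).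
(* Bad squares carry the proof of their defect in a subtype, so that [choice] yields a map which can
   be iterated. *)
pose st := {bt : C * R | ~ sqsum_le g bt.1 bt.2 (eta * bt.2 ^+ 2)}.
have /choice[nxt nxtP] : forall x : st, exists y : st,
    (exists u v, (sval y).1 = subcorner (sval x).1 (sval x).2 u v) /\
    (sval y).2 = (sval x).2 / 3.
  move=> [[b t] /= bt]; have [[u v] uv] := step _ _ bt.
  by exists (exist _ (subcorner b t u v, t / 3) uv) => /=; split => //; exists u, v.
pose sq n := iter n nxt (exist _ (a, s) bad : st).
pose an n := (sval (sq n)).1; pose sn n := (sval (sq n)).2.
have sn0 n : 0 < sn n.
  by elim: n => //= n ih; rewrite /sn /= (nxtP _).2 divr_gt0.
have snE n : sn n = s / 3 ^+ n.
  elim: n => [|n ih]; first by rewrite expr0 divr1.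
  by rewrite /sn /= (nxtP _).2 -/(sn n) ih exprS invfM mulrCA mulrC mulrA.
have mon n : [/\ complex.Re (an n) <= complex.Re (an n.+1),
    complex.Im (an n) <= complex.Im (an n.+1),
    complex.Re (an n.+1) + sn n.+1 <= complex.Re (an n) + sn n &
    complex.Im (an n.+1) + sn n.+1 <= complex.Im (an n) + sn n].
  have [[u [v anE]] snE'] := nxtP (sq n).
  rewrite /an /sn /= anE snE'; apply: subcorner_monotone; exact/ltW/sn0.
have [x xP] := @nested_reals R (fun n => complex.Re (an n))
  (fun n => complex.Re (an n) + sn n) (fun n => let: And4 h _ _ _ := mon n in h)
  (fun n => let: And4 _ _ h _ := mon n in h)
  (fun n => ltW (ltr_pwDr (sn0 n) (lexx _))).
have [y yP] := @nested_reals R (fun n => complex.Im (an n))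
  (fun n => complex.Im (an n) + sn n) (fun n => let: And4 _ h _ _ := mon n in h)
  (fun n => let: And4 _ _ _ h := mon n in h)
  (fun n => ltW (ltr_pwDr (sn0 n) (lexx _))).
pose z := (x +i* y)%C.
have zin n : box (an n) (sn n) z.
  by have /andP[? ?] := xP n; have /andP[? ?] := yP n; apply/boxE.
have [L /cderiv_sqsum_le /(_ eta_gt0)[d d0 dP]] := gd z (zin 0%N).
have [n nd] : exists n, sn n < d.
  have sd : 0 < s / d by rewrite divr_gt0.
  exists (Num.bound (s / d)); rewrite snE ltr_pdivrMr ?exprn_gt0 // -ltr_pdivrMl //.
  rewrite mulrC (lt_le_trans (archi_boundP (ltW sd))) //.
  by rewrite -natrX ler_nat ltnW // ltn_expl.
by case: (svalP (sq n)); apply: (dP (an n) (sn n)) => //; rewrite sn0 nd.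
Qed.

End Goursat.

(** * The winding number of a square *)

Section Cauchy.
Context {R : realType}.
Local Notation C := (R[i]).
Implicit Types F : normedModType C.

Definition center_corner (p : C) (s : R) : C := p - ((s / 2) +i* (s / 2))%C.

Lemma center_corner_sub (p : C) (s : R) :
  subcorner (center_corner p s) s (inord 1) (inord 1) = center_corner p (s / 3).
Proof.
apply: complex_inj; rewrite ?Re_subcorner ?Im_subcorner inordK // !reimE /=.
- by field.
- by field.
Qed.

Lemma ord3_neq1 (u : 'I_3) : u != inord 1 -> u%:R = 0 :> R \/ u%:R = 2 :> R.
Proof.
by rewrite -val_eqE /= inordK //; case: u => -[|[|[|]]] //= _ _; [left|right].
Qed.

Lemma center_notin_sub (p : C) (s : R) (u v : 'I_3) : 0 < s ->
  (u != inord 1) || (v != inord 1) ->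
  ~ box (subcorner (center_corner p s) s u v) (s / 3) p.
Proof.
move=> s0 uv /boxE; rewrite Re_subcorner Im_subcorner !reimE /=.
move: (complex.Re p) (complex.Im p) => x y [h1 h2 h3 h4].
by case/orP: uv => /ord3_neq1[E|E]; rewrite E in h1 h2 h3 h4; lra.
Qed.

Definition derivable_off F (g : C^o -> F) (p : C) (s : R) : Prop :=
  forall z, box (center_corner p s) s z -> z != p -> exists L, cderiv g z L.

Lemma center_box_sub (p : C) (s : R) z : 0 <= s ->
  box (center_corner p (s / 3)) (s / 3) z -> box (center_corner p s) s z.
Proof. by move=> s0; rewrite -center_corner_sub; exact: subcorner_box. Qed.

(** [goursat] disposes of the eight outer parts, which avoid [p], at a cost of [eta / 8] each; the
    middle part is again centred at [p]. *)
Lemma sqsum_le_center F (g : C^o -> F) p s B : 0 < s -> derivable_off g p s ->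
  sqsum_le g (center_corner p (s / 3)) (s / 3) B ->
  forall eta, 0 < eta -> sqsum_le g (center_corner p s) s (B + eta).
Proof.
move=> s0 gd gB eta eta0.
pose BB (u v : 'I_3) := if (u == inord 1) && (v == inord 1) then B else eta / 8.
have -> : B + eta = \sum_(u < 3) \sum_(v < 3) BB u v.
  rewrite !big_ord_recl !big_ord0 /BB -!val_eqE /= !inordK //=.
  by field.
apply: sqsum_le_sub => u v; rewrite /BB.
have [/andP[/eqP -> /eqP ->]|] := boolP (_ && _); first by rewrite center_corner_sub.
rewrite negb_and => uv; apply: goursat; rewrite ?divr_gt0 //.
move=> z zb; apply: gd; first exact: subcorner_box (ltW s0) zb.
by apply: contraPneq zb => ->; exact: center_notin_sub.
Qed.

Lemma sqsum_le_center_iter F (g : C^o -> F) p B m s : 0 < s -> derivable_off g p s ->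
  sqsum_le g (center_corner p (s / 3 ^+ m)) (s / 3 ^+ m) B ->
  forall eta, 0 < eta -> sqsum_le g (center_corner p s) s (B + eta).
Proof.
elim: m s => [|m ih] s s0 gd.
  rewrite expr0 divr1 => -[K KP] eta eta0; exists K => k /KP h.
  by apply: le_trans h _; rewrite lerDl ltW.
rewrite exprS invfM mulrA => gB eta eta0.
(* Half of the budget goes to the eight outer squares of this level, half to the remaining
   descents. *)
have -> : B + eta = B + eta / 2 + eta / 2 by field.
apply: sqsum_le_center; rewrite ?divr_gt0 //.
apply: ih; rewrite ?divr_gt0 // => z zb; apply: gd.
by apply: center_box_sub => //; exact: ltW.
Qed.

Lemma on_rect_center k (p : C) (s : R) z : 0 <= s ->
  on_rect (3 ^ k) (3 ^ k) (center_corner p s) (s / 3 ^+ k)%:C z ->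
  s / 2 <= rnorm (z - p : C^o) <= s.
Proof.
move=> s0 /(on_rect_square s0)[t /andP[t0 t1] H].
have ts0 : 0 <= t * s by rewrite mulr_ge0.
have ts1 : t * s <= s by rewrite ler_piMl.
have [reU imU reim] : [/\ `|complex.Re (z - p)| <= s / 2, `|complex.Im (z - p)| <= s / 2 &
    `|complex.Re (z - p)| = s / 2 \/ `|complex.Im (z - p)| = s / 2].
  have s20 : 0 <= s / 2 by rewrite divr_ge0.
  have ts : `|t * s - s / 2| <= s / 2 by rewrite ler_norml; apply/andP; split; lra.
  have n1 : `|- (s / 2)| = s / 2 by rewrite normrN ger0_norm.
  have n2 : `|s / 2| = s / 2 by rewrite ger0_norm.
  have sE : s - s / 2 = s / 2 by field.
  case: H => ->; rewrite /center_corner !reimE /= !addr0 ?add0r.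
  - have -> : complex.Re p - s / 2 + t * s - complex.Re p = t * s - s / 2 by ring.
    have -> : complex.Im p - s / 2 - complex.Im p = - (s / 2) by ring.
    by rewrite n1; split => //; right.
  - have -> : complex.Re p - s / 2 + t * s - complex.Re p = t * s - s / 2 by ring.
    have -> : complex.Im p - s / 2 + s - complex.Im p = s / 2 by field.
    by rewrite n2; split => //; right.
  - have -> : complex.Im p - s / 2 + t * s - complex.Im p = t * s - s / 2 by ring.
    have -> : complex.Re p - s / 2 - complex.Re p = - (s / 2) by ring.
    by rewrite n1; split => //; left.
  - have -> : complex.Im p - s / 2 + t * s - complex.Im p = t * s - s / 2 by ring.
    have -> : complex.Re p - s / 2 + s - complex.Re p = s / 2 by field.
    by rewrite n2; split => //; left.
have := rnorm_ReIm (z - p); have := rnorm_Re (z - p); have := rnorm_Im (z - p).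
move=> h1 h2 h3; apply/andP; split; last by lra.
by case: reim => <-.
Qed.

Lemma sqsum_bound_center F (g : C^o -> F) (p : C) (s M : R) k : 0 < s ->
  (forall z : C^o, s / 2 <= rnorm (z - p) <= s -> rnorm (g z) <= M) ->
  rnorm (sqsum g k (center_corner p s) s) <= 4 * s * M.
Proof.
move=> s0 gM; rewrite /sqsum.
apply: (le_trans (rectsum_bound (M := M) _)).
  by move=> z /(on_rect_center (ltW s0)); exact: gM.
rewrite rnorm_real ger0_norm; last by rewrite divr_ge0 ?exprn_ge0 // ltW.
rewrite natrD natrX le_eqVlt; apply/orP; left; apply/eqP.
by field; rewrite expf_neq0.
Qed.

(* The middle square of side [s / 3 ^ m] has boundary sum at most its perimeter
   times [o(3 ^ m / s)]. *)
Lemma sqsum_le_removable F (g : C^o -> F) (p : C) s : 0 < s -> derivable_off g p s ->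
  (forall e : R, 0 < e -> exists2 d : R, 0 < d & forall z : C^o, 0 < rnorm (z - p) < d ->
     rnorm (g z) <= e / rnorm (z - p)) ->
  forall eta, 0 < eta -> sqsum_le g (center_corner p s) s eta.
Proof.
(* The constant is calibrated to a perimeter [4 * r] at distance at least [r / 2] from the centre:
   [4 * r * (eta / 16 / (r / 2)) = eta / 2]. *)
move=> s0 gd go eta eta0; have [|d d0 dP] := go (eta / 16); first by rewrite divr_gt0.
have [m md] : exists m, s / 3 ^+ m < d.
  have sd : 0 < s / d by rewrite divr_gt0.
  exists (Num.bound (s / d)); rewrite ltr_pdivrMr ?exprn_gt0 // -ltr_pdivrMl //.
  rewrite mulrC (lt_le_trans (archi_boundP (ltW sd))) //.
  by rewrite -natrX ler_nat ltnW // ltn_expl.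
have -> : eta = eta / 2 + eta / 2 by field.
apply: (@sqsum_le_center_iter _ _ _ _ m); rewrite ?divr_gt0 //.
have sm0 : 0 < s / 3 ^+ m by rewrite divr_gt0 ?exprn_gt0.
move: (s / 3 ^+ m) sm0 md => r r0 rd.
exists 0%N => k _.
have -> : eta / 2 = 4 * r * (eta / 16 / (r / 2)) by field; rewrite gt_eqF.
apply: sqsum_bound_center => // z /andP[z1 z2].
have z0 : 0 < rnorm (z - p) by apply: lt_le_trans z1; rewrite divr_gt0.
apply: le_trans (dP z _) _; first by rewrite z0 (le_lt_trans z2).
have r2 : 0 < r / 2 by rewrite divr_gt0.
by apply: ler_wpM2l; [rewrite divr_ge0 // ltW|rewrite lef_pV2 ?posrE].
Qed.

Lemma Im_sum (I : Type) (r : seq I) (P : pred I) (f : I -> C) :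
  complex.Im (\sum_(i <- r | P i) f i) = \sum_(i <- r | P i) complex.Im (f i).
Proof. exact: (big_morph _ (@ImD R) (erefl _)). Qed.

Lemma Im_inv (w : C) : complex.Im w^-1 =
  - (complex.Im w / (complex.Re w ^+ 2 + complex.Im w ^+ 2)).
Proof. by case: w. Qed.

Lemma Re_inv (w : C) : complex.Re w^-1 =
  complex.Re w / (complex.Re w ^+ 2 + complex.Im w ^+ 2).
Proof. by case: w. Qed.

Lemma Im_segsum_ge (g : C^o -> C^o) n (a h : C) (c : R) :
  (forall j : 'I_n, c <= complex.Im (h * g (a + h * (j%:R + 2^-1)))) ->
  n%:R * c <= complex.Im (segsum g n a h).
Proof.
move=> H; rewrite /segsum Im_sum.
have -> : n%:R * c = \sum_(j < n) c by rewrite sumr_const card_ord mulr_natl.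
by apply: ler_sum => j _; exact: H.
Qed.

(* The winding number of the boundary of the square around its centre,
   bounded below: each of the four sides contributes at least 1. *)
Lemma Im_sqsum_inv k (p : C) (s : R) : 0 < s ->
  4 <= complex.Im (sqsum (fun z : C^o => (z - p)^-1 : C^o) k (center_corner p s) s).
Proof.
move=> s0; rewrite /sqsum /rectsum.
set N := (3 ^ k)%N; set h := s / 3 ^+ k.
have h0 : 0 < h by rewrite divr_gt0 ?exprn_gt0.
have Nh : N%:R * (h / s) = 1.
  by rewrite /h /N natrX; field; rewrite expf_neq0 // gt_eqF.
have hN : h%:C * N%:R = s%:C.
  by rewrite -(rmorph_nat (real_complex R)) -rmorphM /h /N natrX divfK.
have hN' t : h%:C * (t * N%:R)%:C = (t * s)%:C.
  have -> : (t * N%:R)%:C = N%:R * t%:C :> C by rewrite mulrC rmorphM rmorph_nat.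
  by rewrite mulrA hN -rmorphM mulrC.
have I x : x%:C * 'i%C = (x *i)%C by simpc.
(* On each side the relevant imaginary part is [s / 2] over the squared distance to the centre. That
   squared distance is largest at the corners, where it is [s ^ 2 / 2]; hence a density of at least
   [1 / s]. *)
have key t : 0 <= t <= 1 -> h / s <= h * (s / 2 / ((t * s - s / 2) ^+ 2 + (s / 2) ^+ 2)).
  move=> /andP[t0 t1].
  rewrite ler_wpM2l ?(ltW h0) //.
  have D0 : 0 < (t * s - s / 2) ^+ 2 + (s / 2) ^+ 2.
    by rewrite ltr_wpDl ?sqr_ge0 // exprn_gt0 // divr_gt0.
  rewrite ler_pdivlMr // ler_pdivrMl //.
  have -> : (t * s - s / 2) ^+ 2 + (s / 2) ^+ 2 = s * (s / 2) - s * s * (t * (1 - t)) by field.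
  by rewrite gerBl !mulr_ge0 ?subr_ge0 // ltW.
have imE (a b c d : C) : complex.Im (a - b + (c - d)) =
    complex.Im a - complex.Im b + (complex.Im c - complex.Im d).
  by rewrite !reimE.
rewrite imE.
have cc : center_corner p s = p - ((s / 2) +i* (s / 2))%C by [].
have b1 : 1 <= complex.Im (segsum (fun z : C^o => (z - p)^-1 : C^o) N (center_corner p s) h%:C).
  rewrite -[X in X <= _]Nh; apply: Im_segsum_ge => j; have [t /key kt ->] := @midpoint_ratio R _ j.
  rewrite hN' cc; apply: le_trans kt _.
  rewrite ImM Im_inv Re_inv !reimE /= !mul0r !addr0.
  have -> : complex.Re p - s / 2 + t * s - complex.Re p = t * s - s / 2 by ring.
  have -> : complex.Im p - s / 2 - complex.Im p = - (s / 2) by ring.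
  by rewrite sqrrN mulNr opprK.
have b3 : 1 <= complex.Im (segsum (fun z : C^o => (z - p)^-1 : C^o) N (center_corner p s + h%:C * N%:R) (h%:C * 'i%C)).
  rewrite -[X in X <= _]Nh; apply: Im_segsum_ge => j; have [t /key kt ->] := @midpoint_ratio R _ j.
  rewrite hN cc [_ * 'i%C * (_)%:C]mulrAC hN' !I; apply: le_trans kt _.
  rewrite ImM Im_inv Re_inv !reimE /= !mul0r !addr0 add0r.
  have -> : complex.Im p - s / 2 + t * s - complex.Im p = t * s - s / 2 by ring.
  have -> : complex.Re p - s / 2 + s - complex.Re p = s / 2 by field.
  by rewrite [(s / 2) ^+ 2 + _]addrC.
(* The top and left sides enter with a minus sign; negating the integrand makes the same lower bound
   applicable. *)
have segN (g : C^o -> C^o) n a l : segsum g n a l = - segsum (fun z => - g z) n a l.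
  by rewrite /segsum -sumrN; apply: eq_bigr => j _; rewrite scalerN opprK.
have b2 : 1 <= - complex.Im (segsum (fun z : C^o => (z - p)^-1 : C^o) N (center_corner p s + h%:C * 'i%C * N%:R) h%:C).
  rewrite segN ImN opprK -[X in X <= _]Nh; apply: Im_segsum_ge => j; have [t /key kt ->] := @midpoint_ratio R _ j.
  rewrite hN' cc [_ * 'i%C * N%:R]mulrAC hN !I; apply: le_trans kt _.
  rewrite ImM !reimE Im_inv Re_inv !reimE /= !mul0r !addr0.
  have -> : complex.Re p - s / 2 + t * s - complex.Re p = t * s - s / 2 by ring.
  have -> : complex.Im p - s / 2 + s - complex.Im p = s / 2 by field.
  by rewrite opprK.
have b4 : 1 <= - complex.Im (segsum (fun z : C^o => (z - p)^-1 : C^o) N (center_corner p s) (h%:C * 'i%C)).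
  rewrite segN ImN opprK -[X in X <= _]Nh; apply: Im_segsum_ge => j; have [t /key kt ->] := @midpoint_ratio R _ j.
  rewrite cc [_ * 'i%C * (_)%:C]mulrAC hN' !I; apply: le_trans kt _.
  rewrite ImM !reimE Im_inv Re_inv !reimE /= !mul0r !addr0 add0r.
  have -> : complex.Im p - s / 2 + t * s - complex.Im p = t * s - s / 2 by ring.
  have -> : complex.Re p - s / 2 - complex.Re p = - (s / 2) by ring.
  by rewrite sqrrN mulNr opprK [(s / 2) ^+ 2 + _]addrC.
move: (complex.Im _) (complex.Im _) (complex.Im _) (complex.Im _) b1 b2 b3 b4.
by move=> *; lra.
Qed.

End Cauchy.

(** * Cauchy's estimate *)

Section CauchyEstimates.
Context {R : realType}.
Local Notation C := (R[i]).
Implicit Types F : normedModType C.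

Lemma cderiv_cts F (g : C^o -> F) z L : cderiv g z L ->
  forall e : R, 0 < e -> exists2 d : R, 0 < d & forall y : C^o,
    rnorm (y - z) < d -> rnorm (g y - g z) <= e.
Proof.
move=> gL e e0; have [d d0 dP] := gL _ ltr01.
have L1 : 0 < rnorm L + 1 by rewrite ltr_wpDl ?rnorm_ge0.
exists (Num.min d (e / (rnorm L + 1))); first by rewrite lt_min d0 divr_gt0.
move=> y; rewrite lt_min => /andP[/dP h yd].
have -> : g y - g z = (g y - g z - (y - z) *: L) + (y - z) *: L by rewrite subrK.
apply: le_trans (rnormD _ _) _; rewrite rnormZ.
move: yd; rewrite ltr_pdivlMr // => yd.
apply: le_trans (ltW yd); rewrite mulrDr mulr1 addrC lerD2l.
by rewrite mul1r in h.
Qed.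

Lemma cderivZ F (k : C^o -> C^o) (g : C^o -> F) z a L :
  cderiv k z a -> cderiv g z L ->
  cderiv (fun y => (k y : C) *: g y) z ((a : C) *: g z + (k z : C) *: L).
Proof.
move=> ka gL e e0.
pose A := rnorm (k z) + 1; pose B := rnorm (g z) + 1; pose D := rnorm L + 1.
have A0 : 0 < A by rewrite ltr_wpDl ?rnorm_ge0.
have B0 : 0 < B by rewrite ltr_wpDl ?rnorm_ge0.
have D0 : 0 < D by rewrite ltr_wpDl ?rnorm_ge0.
have e30 : 0 < e / 3 by rewrite divr_gt0.
have [d1 d10 d1P] := gL _ (divr_gt0 e30 A0).
have [d2 d20 d2P] := ka _ (divr_gt0 e30 B0).
have [d3 d30 d3P] := cderiv_cts ka (divr_gt0 e30 D0).
have [d4 d40 d4P] := cderiv_cts ka ltr01.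
exists (Num.min (Num.min d1 d2) (Num.min d3 d4)); first by rewrite !lt_min d10 d20 d30 d40.
move=> y; rewrite !lt_min => /andP[/andP[/d1P h1 /d2P h2] /andP[/d3P h3 /d4P h4]].
(* The three terms are the remainder of [g], the increment of [k] times the linear part of [g], and
   the remainder of [k]; each receives a third of [e]. *)
have -> : (k y : C) *: g y - (k z : C) *: g z - (y - z) *: ((a : C) *: g z + (k z : C) *: L) =
  (k y : C) *: (g y - g z - (y - z) *: L) + (k y - k z : C) *: ((y - z) *: L)
  + (k y - k z - (y - z) *: a : C) *: g z.
  move: (y - z : C^o) => w.
  rewrite [in RHS]scalerBr [(k y - k z) *: _]scalerBl addrA subrK.
  rewrite scalerBr !scalerBl scalerDr.
  have -> : (w *: a : C) *: g z = (w : C) *: ((a : C) *: g z) by rewrite scalerA.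
  have -> : (k z : C) *: ((w : C) *: L) = (w : C) *: ((k z : C) *: L).
    by rewrite !scalerA mulrC.
  rewrite !opprD !addrA.
  by rewrite [RHS](AC 6 (1*5*6*3*(2*4)))/= addNr addr0.
set N := rnorm (y - z) in h1 h2 *; have N0 : 0 <= N := rnorm_ge0 _.
have -> : e * N = e / 3 / A * N * A + e / 3 / D * N * D + e / 3 / B * N * B.
  by field; rewrite !gt_eqF.
have kyA : rnorm (k y) <= A.
  by have := rnormD (k y - k z) (k z); rewrite subrK /A; lra.
apply: le_trans (rnormD _ _) (lerD (le_trans (rnormD _ _) (lerD _ _)) _); rewrite rnormZ.
- by rewrite mulrC; apply: ler_pM; rewrite ?rnorm_ge0.
- rewrite rnormZ mulrA; apply: ler_pM; rewrite ?mulr_ge0 ?rnorm_ge0 //.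
    by rewrite ler_wpM2r.
  by rewrite lerDl ler01.
- by apply: ler_pM; rewrite ?rnorm_ge0 // lerDl ler01.
Qed.

(** Mean value inequality by bisection: an interval on which the slope exceeds [K + e] has a half
    with the same defect. The local estimate at the common point of the nested intervals, applied to
    the endpoints on both sides of it, contradicts this. *)
Lemma unit_interval_lipschitz F (u : R -> F) (K : R) :
  (forall c : R, 0 <= c <= 1 -> forall e : R, 0 < e -> exists2 d : R, 0 < d & forall t,
     `|t - c| < d -> rnorm (u t - u c) <= (K + e) * `|t - c|) ->
  rnorm (u 1 - u 0) <= K.
Proof.
move=> uK; apply/ler_addgt0Pr => e e0.
pose good (ab : R * R) : Prop := rnorm (u ab.2 - u ab.1) <= (K + e) * (ab.2 - ab.1).
have [g01|bad] := pselect (good (0, 1)).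
  by move: g01; rewrite /good /= subr0 mulr1.
pose st := {ab : R * R | ~ good ab}.
have /choice[nxt nxtP] : forall x : st, exists y : st,
   let m := ((sval x).1 + (sval x).2) / 2 in
   sval y = ((sval x).1, m) \/ sval y = (m, (sval x).2).
  move=> [[a b] /= ab].
  have [gl|] := pselect (good (a, (a + b) / 2)); last first.
    by move=> h; exists (exist (fun x => ~ good x) _ h); left.
  have [gr|] := pselect (good ((a + b) / 2, b)); last first.
    by move=> h; exists (exist (fun x => ~ good x) _ h); right.
  exfalso; apply: ab; rewrite /good /= in gl gr *.
  apply: le_trans (rnorm_subD (u ((a + b) / 2)) _ _) _.
  have -> : (K + e) * (b - a) = (K + e) * (b - (a + b) / 2) + (K + e) * ((a + b) / 2 - a) by field.
  exact: lerD.
pose sq n := iter n nxt (exist (fun x => ~ good x) (0, 1) bad : st).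
pose an n := (sval (sq n)).1; pose bn n := (sval (sq n)).2.
have lenE n : bn n - an n = 2^-1 ^+ n.
  elim: n => [|n ih]; first by rewrite expr0 subr0.
  rewrite /bn /an /=; case: (nxtP (sq n)) => -> /=; rewrite -/(an n) -/(bn n) exprS -ih;
  by field.
have len0 n : 0 < bn n - an n by rewrite lenE exprn_gt0 // invr_gt0.
have mon n : an n <= an n.+1 /\ bn n.+1 <= bn n.
  have := len0 n; rewrite {3}/an {2}/bn /=.
  by case: (nxtP (sq n)) => -> /=; rewrite -/(an n) -/(bn n) => *; split; lra.
have [c cP] := nested_reals (fun n => (mon n).1) (fun n => (mon n).2)
  (fun n => ltW (eq_ind_r is_true (len0 n) (esym (subr_gt0 _ _)))).
have c01 : 0 <= c <= 1 := cP 0%N.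
have [d d0 dP] := uK c c01 e e0.
have [n nd] : exists n, 2^-1 ^+ n < d.
  exists (Num.bound d^-1); rewrite exprVn invf_plt ?posrE ?exprn_gt0 //.
  have d'0 : 0 < d^-1 by rewrite invr_gt0.
  rewrite (lt_le_trans (archi_boundP (ltW d'0))) //.
  by rewrite -natrX ler_nat ltnW // ltn_expl.
case: (svalP (sq n)); rewrite /good -/(an n) -/(bn n).
have /andP[ac cb] := cP n; have ln := lenE n.
have aE : `|an n - c| = c - an n by rewrite distrC ger0_norm // subr_ge0.
have bE : `|bn n - c| = bn n - c by rewrite ger0_norm // subr_ge0.
have h1 := dP (an n); have h2 := dP (bn n).
rewrite aE in h1; rewrite bE in h2.
apply: le_trans (rnorm_subD (u c) _ _) _.
have -> : (K + e) * (bn n - an n) = (K + e) * (bn n - c) + (K + e) * (c - an n) by ring.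
by apply: lerD; [apply: h2; lra|rewrite rnormBC; apply: h1; lra].
Qed.

Lemma cderiv_segment_lipschitz F (g : C^o -> F) (x y : C^o) (K : R) :
  (forall t : R, 0 <= t <= 1 -> exists2 L, cderiv g (x + t%:C * (y - x)) L & rnorm L <= K) ->
  rnorm (g y - g x) <= K * rnorm (y - x).
Proof.
move=> H; pose u t := g (x + t%:C * (y - x)).
have -> : g y = u 1 by rewrite /u mul1r addrC subrK.
have -> : g x = u 0 by rewrite /u mul0r addr0.
have K0 : 0 <= K.
  have [|L _ ] := H 0; first by rewrite lexx ler01.
  by apply: le_trans; exact: rnorm_ge0.
apply: unit_interval_lipschitz => c /H[L gL LK] e e0.
pose N := rnorm (y - x) + 1; have N0 : 0 < N by rewrite ltr_wpDl ?rnorm_ge0.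
have [d d0 dP] := gL (e / N) (divr_gt0 e0 N0).
exists (d / N); first by rewrite divr_gt0.
move=> t; rewrite ltr_pdivlMr // => tc.
have E : (x + t%:C * (y - x)) - (x + c%:C * (y - x)) = (t - c)%:C * (y - x) :> C^o.
  by rewrite rmorphB; ring.
have NE : rnorm ((t - c)%:C * (y - x) : C^o) = `|t - c| * rnorm (y - x).
  by rewrite rnormM rnorm_real.
have := dP (x + t%:C * (y - x)); rewrite E NE => h.
have {}h : rnorm (u t - u c - (t - c)%:C * (y - x) *: L) <= e / N * (`|t - c| * rnorm (y - x)).
  apply: h; have : `|t - c| * rnorm (y - x) <= `|t - c| * N.
    by apply: ler_wpM2l => //; rewrite lerDl ler01.
  by move/le_lt_trans; apply.
have -> : u t - u c = u t - u c - ((t - c)%:C * (y - x)) *: L + ((t - c)%:C * (y - x)) *: L.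
  by rewrite subrK.
apply: le_trans (rnormD _ _) _; rewrite rnormZ NE addrC.
have -> : (K * rnorm (y - x) + e) * `|t - c| = `|t - c| * rnorm (y - x) * K + e / N * (`|t - c| * N).
  by field; rewrite gt_eqF.
apply: lerD; first by rewrite ler_wpM2l // mulr_ge0 ?rnorm_ge0.
apply: le_trans h _; apply: ler_wpM2l; first by rewrite divr_ge0 ?ltW.
by apply: ler_wpM2l => //; rewrite lerDl ler01.
Qed.


Definition hol_disc F (g : C^o -> F) (p : C^o) (r : R) : Prop :=
  forall z : C^o, rnorm (z - p) < r -> exists L, cderiv g z L.

Lemma hol_disc_sub F (g : C^o -> F) (p q : C^o) (r s : R) :
  rnorm (q - p) + s <= r -> hol_disc g p r -> hol_disc g q s.
Proof.
move=> qp gd z zq; apply: gd; have := rnorm_subD q z p; lra.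
Qed.

Lemma cderiv_inv_sqr (p z : C^o) : z != p ->
  exists L, cderiv (fun y : C^o => ((y - p)^-1 ^+ 2 : C) : C^o) z L.
Proof.
move=> zp; apply/differentiable_cderivP.
have dB : differentiable (fun y : C^o => y - p) z by exact: differentiableB.
have dV : differentiable (fun y : C^o => (y - p)^-1 : C^o) z.
  by apply: (differentiableV dB); rewrite subr_eq0.
by have := differentiableX 1 dV; rewrite exprfctE.
Qed.

Lemma box_center_rnorm (p : C) (s : R) z :
  box (center_corner p s) s z -> rnorm (z - p : C^o) <= s.
Proof.
move=> /boxE; rewrite /center_corner !reimE /= => -[h1 h2 h3 h4].
apply: le_trans (rnorm_ReIm _) _; rewrite !reimE.
move: (complex.Re z) (complex.Im z) (complex.Re p) (complex.Im p) h1 h2 h3 h4.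
move=> x y u v *.
have : `|x - u| <= s / 2 by rewrite ler_norml; apply/andP; split; lra.
have : `|y - v| <= s / 2 by rewrite ler_norml; apply/andP; split; lra.
by lra.
Qed.

(* With [h z = (g z - g p - (z - p) L) / (z - p)^2], which is [o(1 / |z - p|)],
   the sums of [h] around [p] tend to 0, so that those of [L / (z - p)] are
   asymptotically those of [(g z - g p) / (z - p)^2]. *)
Lemma cauchy_estimate F (g : C^o -> F) (p : C^o) L (r M : R) : 0 < r ->
  hol_disc g p r -> (forall z : C^o, rnorm (z - p) < r -> rnorm (g z) <= M) ->
  cderiv g p L -> rnorm L <= 16 * M / r.
Proof.
move=> r0 gd gM gL; pose s := r / 2.
have s0 : 0 < s by rewrite divr_gt0.
have sr : s < r by rewrite /s; lra.
pose h z : F := (z - p)^-1 ^+ 2 *: (g z - g p - (z - p) *: L).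
have hd : derivable_off h p s.
  move=> z /box_center_rnorm zs zp.
  have [a ka] := cderiv_inv_sqr zp.
  have [|Lz gz] := gd z; first exact: le_lt_trans zs sr.
  exists ((a : C) *: (g z - g p - (z - p) *: L) + ((z - p)^-1 ^+ 2) *: (Lz - L)).
  apply: (cderivZ ka) => e /gz[d d0 dP]; exists d => // y /dP.
  have -> : g y - g z - (y - z) *: Lz =
    g y - g p - (y - p) *: L - (g z - g p - (z - p) *: L) - (y - z) *: (Lz - L) => //.
  rewrite scalerBr; have -> : (y - z) *: L = (y - p) *: L - (z - p) *: L.
    by rewrite -scalerBl; congr (_ *: _); ring.
  rewrite !opprD !opprK !addrA.
  by rewrite [RHS](AC 9 (1*4*7*(2*5)*(3*8)*(6*9)))/= !addNr subrr !addr0.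
have ho e : 0 < e -> exists2 d : R, 0 < d & forall z : C^o, 0 < rnorm (z - p) < d ->
    rnorm (h z) <= e / rnorm (z - p).
  move=> /gL[d d0 dP]; exists d => // z /andP[z0 /dP zp].
  rewrite /h rnormZ rnormX rnormV; move: zp z0; set N := rnorm (z - p) => zp z0.
  have -> : e / N = N^-1 ^+ 2 * (e * N) by field; rewrite gt_eqF.
  by rewrite ler_wpM2l // exprn_ge0 // invr_ge0 ltW.
(* At [z = p] the identity holds because the inverse of 0 is 0. *)
have split_h z : (z - p)^-1 *: L = (z - p)^-1 ^+ 2 *: (g z - g p) - h z.
  rewrite /h -scalerBr subKr scalerA.
  have [->|zp] := eqVneq z p; first by rewrite subrr invr0 mulr0.
  by congr (_ *: _); field; rewrite subr_eq0.
have sqE k : sqsum (fun z => (z - p)^-1 *: L) k (center_corner p s) s =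
    (sqsum (fun z : C^o => (z - p)^-1 : C^o) k (center_corner p s) s : C) *: L.
  have segE n a l : segsum (fun z => (z - p)^-1 *: L) n a l =
      (segsum (fun z : C^o => (z - p)^-1 : C^o) n a l : C) *: L.
    by rewrite /segsum scaler_suml; apply: eq_bigr => j _; rewrite scalerA.
  by rewrite /sqsum /rectsum !segE -!scalerBl -!scalerDl.
apply/ler_addgt0Pr => e e0.
have e40 : 0 < 4 * e by rewrite mulr_gt0.
have [k /(_ k (leqnn k)) hk] := sqsum_le_removable s0 hd ho e40.
have low := Im_sqsum_inv k p s0.
have low2 : 4 * rnorm L <= rnorm (sqsum (fun z => (z - p)^-1 *: L) k (center_corner p s) s).
  rewrite sqE rnormZ ler_wpM2r ?rnorm_ge0 //; apply: le_trans low _.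
  by apply: le_trans (rnorm_Im _); rewrite ler_norm.
have up : rnorm (sqsum (fun z => (z - p)^-1 ^+ 2 *: (g z - g p)) k (center_corner p s) s)
    <= 4 * s * ((s / 2)^-1 ^+ 2 * (2 * M)).
  apply: sqsum_bound_center => // z /andP[z1 z2].
  rewrite rnormZ rnormX rnormV ler_pM ?exprn_ge0 ?invr_ge0 ?rnorm_ge0 //.
    have s20 : 0 < s / 2 by rewrite divr_gt0.
    rewrite lerXn2r ?nnegrE ?invr_ge0 ?rnorm_ge0 ?(ltW s20) //.
    by rewrite lef_pV2 ?posrE //; exact: lt_le_trans z1.
  have := gM z (le_lt_trans z2 sr); have := gM p; rewrite subrr rnorm0 => /(_ r0).
  by have := rnormB (g z) (g p); lra.
have E : sqsum (fun z => (z - p)^-1 *: L) k (center_corner p s) s =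
    sqsum (fun z => (z - p)^-1 ^+ 2 *: (g z - g p)) k (center_corner p s) s
    - sqsum h k (center_corner p s) s.
  rewrite /sqsum -rectsumB; congr (rectsum _ _ _ _ _).
  by apply/funext => z; exact: split_h.
have := rnormB (sqsum (fun z => (z - p)^-1 ^+ 2 *: (g z - g p)) k (center_corner p s) s)
  (sqsum h k (center_corner p s) s).
rewrite -E => tri.
(* With [s = r / 2] the contour bound is [64 * M / r]; dividing by the winding bound 4 gives the
   constant 16. *)
have vE : 4 * s * ((s / 2)^-1 ^+ 2 * (2 * M)) = 4 * (16 * M / r).
  by rewrite /s; field; rewrite gt_eqF.
rewrite vE in up.
move: tri low2 up hk; move: (rnorm (sqsum _ _ _ _)) (rnorm (sqsum _ _ _ _)) (rnorm (sqsum _ _ _ _)).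
by move: (16 * M / r) => *; lra.
Qed.

(** Cauchy's estimate on discs of radius [r / 2] about the points of the segment bounds the
    derivative by [16 * M / (r / 2)]. *)
Lemma hol_disc_lipschitz F (g : C^o -> F) (p : C^o) (r M : R) : 0 < r ->
  hol_disc g p r -> (forall z : C^o, rnorm (z - p) < r -> rnorm (g z) <= M) ->
  forall x y : C^o, rnorm (x - p) < r / 2 -> rnorm (y - p) < r / 2 ->
  rnorm (g y - g x) <= 32 * M / r * rnorm (y - x).
Proof.
move=> r0 gd gM x y xp yp; apply: cderiv_segment_lipschitz => t /andP[t0 t1].
set z := x + _.
have zp : rnorm (z - p) < r / 2.
  have -> : z - p = (1 - t)%:C *: (x - p) + t%:C *: (y - p) :> C^o.
    by rewrite /z /GRing.scale /= rmorphB rmorph1; ring.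
  apply: le_lt_trans (rnormD _ _) _; rewrite !rnormZ !rnorm_real !ger0_norm ?subr_ge0 //.
  move: (rnorm (x - p)) (rnorm (y - p)) xp yp => a b ar br.
  have mr : Num.max a b < r / 2 by rewrite gt_max ar br.
  have ha : (1 - t) * a <= (1 - t) * Num.max a b.
    by rewrite ler_wpM2l ?subr_ge0 // le_max lexx.
  have hb : t * b <= t * Num.max a b by rewrite ler_wpM2l // le_max lexx orbT.
  by move: (Num.max a b) mr ha hb => m *; lra.
have zr : rnorm (z - p) < r by lra.
have [L gL] := gd z zr; exists L => //.
have r20 : 0 < r / 2 by rewrite divr_gt0.
have -> : 32 * M / r = 16 * M / (r / 2) by field; rewrite gt_eqF.
apply: (cauchy_estimate r20 _ _ gL); first by apply: hol_disc_sub gd; lra.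
by move=> w wz; apply: gM; have := rnorm_subD z w p; lra.
Qed.

End CauchyEstimates.

(** * Taylor bounds and limits of holomorphic maps *)

Section Limits.
Context {R : realType}.
Local Notation C := (R[i]).
Implicit Types E F : normedModType C.

Lemma cderiv_shift F (g : C^o -> F) (z k : C^o) L :
  cderiv g (z + k) L -> cderiv (fun y => g (y + k)) z L.
Proof.
move=> gL e /gL[d d0 dP]; exists d => // y yz.
by have := dP (y + k); rewrite (_ : y + k - (z + k) = y - z); [apply|ring].
Qed.

Lemma cderivB F (g1 g2 : C^o -> F) (z : C^o) L1 L2 :
  cderiv g1 z L1 -> cderiv g2 z L2 -> cderiv (fun y => g1 y - g2 y) z (L1 - L2).
Proof.
move=> h1 h2 e e0; have e20 : 0 < e / 2 by rewrite divr_gt0.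
have [d1 d10 d1P] := h1 _ e20; have [d2 d20 d2P] := h2 _ e20.
exists (Num.min d1 d2); first by rewrite lt_min d10.
move=> y; rewrite lt_min => /andP[/d1P b1 /d2P b2].
have -> : g1 y - g2 y - (g1 z - g2 z) - (y - z) *: (L1 - L2) =
  (g1 y - g1 z - (y - z) *: L1) - (g2 y - g2 z - (y - z) *: L2).
  rewrite scalerBr; move: (_ *: L1) (_ *: L2) => u v.
  by rewrite !opprD !opprK !addrA [RHS](AC 6 (1*4*2*5*3*6))/=.
by apply: le_trans (rnormB _ _) _; lra.
Qed.

Lemma cderivZr F (g : C^o -> F) (z : C^o) L (a : C) :
  cderiv g z L -> cderiv (fun y => a *: g y) z (a *: L).
Proof.
move=> h e e0; have a1 : 0 < rnorm (a : C^o) + 1 by rewrite ltr_wpDl ?rnorm_ge0.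
have [d d0 dP] := h _ (divr_gt0 e0 a1); exists d => // y /dP b.
rewrite [_ *: (a *: L)]scalerA mulrC -scalerA -!scalerBr rnormZ.
have : (rnorm (a : C^o) + 1) * (e / (rnorm (a : C^o) + 1) * rnorm (y - z)) = e * rnorm (y - z).
  by field; rewrite gt_eqF.
move=> <-; apply: ler_pM; rewrite ?rnorm_ge0 //.
by rewrite lerDl ler01.
Qed.

Lemma cderiv_quotient F (g : C^o -> F) (z : C^o) L (e : R) : cderiv g z L -> 0 < e ->
  exists2 d : R, 0 < d & forall k : C^o, 0 < rnorm k < d ->
    rnorm ((k : C)^-1 *: (g (z + k) - g z) - L) <= e.
Proof.
move=> gL /gL[d d0 dP]; exists d => // k /andP[k0 kd].
have := dP (z + k); rewrite (_ : z + k - z = k); last by ring.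
move=> /(_ kd) h.
have kn : (k : C) != 0 by apply: contraTneq k0 => ->; rewrite rnorm0 ltxx.
have -> : (k : C)^-1 *: (g (z + k) - g z) - L = (k : C)^-1 *: (g (z + k) - g z - k *: L).
  by rewrite [RHS]scalerBr scalerA mulVf // scale1r.
by rewrite rnormZ rnormV mulrC ler_pdivrMr.
Qed.

(* The difference quotients of [g] are holomorphic and uniformly bounded, so
   Cauchy's estimate makes them Lipschitz with a constant independent of the
   increment. *)
Lemma hol_disc_deriv_lipschitz F (g : C^o -> F) (p : C^o) (r M : R) : 0 < r ->
  hol_disc g p r -> (forall z : C^o, rnorm (z - p) < r -> rnorm (g z) <= M) ->
  forall (z w : C^o) Lz Lw, rnorm (z - p) < r / 8 -> rnorm (w - p) < r / 8 ->
  cderiv g z Lz -> cderiv g w Lw ->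
  rnorm (Lw - Lz) <= (64 * 64) * M / r ^+ 2 * rnorm (w - z).
Proof.
move=> r0 gd gM z w Lz Lw zp wp gz gw; apply/ler_addgt0Pr => e e0.
have e20 : 0 < e / 2 by rewrite divr_gt0.
have [d1 d10 d1P] := cderiv_quotient gz e20.
have [d2 d20 d2P] := cderiv_quotient gw e20.
(* The increment must be small enough for both difference quotients to be [e / 2]-close to the
   derivatives, and for translation by it to stay inside the disc. *)
pose d := Num.min (Num.min d1 d2) (r / 4).
have d0 : 0 < d by rewrite !lt_min d10 d20 divr_gt0.
pose k : C^o := (d / 2)%:C.
have kE : rnorm k = d / 2 by rewrite rnorm_real ger0_norm // divr_ge0 // ltW.
have kd : rnorm k < d by rewrite kE; lra.
have k0 : 0 < rnorm k by rewrite kE divr_gt0.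
move: (kd); rewrite !lt_min => /andP[/andP[kd1 kd2] kr].
have {d1P}b1 := d1P k; have {d2P}b2 := d2P k.
rewrite k0 kd1 in b1; rewrite k0 kd2 in b2.
have {}b1 := b1 isT; have {}b2 := b2 isT.
pose D (y : C^o) := (k : C)^-1 *: (g (y + k) - g y).
have shift_in y s : rnorm (y - p) < s -> rnorm (y + k - p) < s + r / 4.
  move=> ys; have := rnormD (y - p) k.
  by rewrite (_ : y - p + k = y + k - p); [lra|ring].
have r40 : 0 < r / 4 by rewrite divr_gt0.
have Dd : hol_disc D p (r / 4).
  move=> y yp; have [|L1 h1] := gd (y + k); first by have := shift_in _ _ yp; lra.
  have [|L2 h2] := gd y; first by lra.
  by exists ((k : C)^-1 *: (L1 - L2)); apply: cderivZr; apply: cderivB => //; exact: cderiv_shift.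
have DM y : rnorm (y - p) < r / 4 -> rnorm (D y) <= 32 * M / r.
  move=> yp; rewrite /D rnormZ rnormV mulrC ler_pdivrMr //.
  have := @hol_disc_lipschitz _ _ g p r M r0 gd gM y (y + k).
  rewrite (_ : y + k - y = k); last by ring.
  by apply; [lra|have := shift_in _ _ yp; lra].
have := hol_disc_lipschitz r40 Dd DM (x := z) (y := w).
have -> : r / 4 / 2 = r / 8 by field.
move=> /(_ zp wp).
(* The quotients are bounded by [32 * M / r] on a disc of radius [r / 4]; the second use of the
   Lipschitz bound produces [64 * 64]. *)
have -> : 32 * (32 * M / r) / (r / 4) = (64 * 64) * M / r ^+ 2 by field; rewrite gt_eqF.
move=> Dl.
have := rnorm_subD (D w) Lw Lz; have := rnorm_subD (D z) (D w) Lz.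
rewrite [rnorm (Lw - D w)]rnormBC.
rewrite -/(D z) in b1; rewrite -/(D w) in b2.
move: ((64 * 64) * M / r ^+ 2 * _) Dl => K Dl; lra.
Qed.

(** Mean value inequality for [g z - (z - p) *: L], whose derivative [Lz - L] is controlled by the
    Lipschitz bound on derivatives. *)
Lemma hol_disc_second_order F (g : C^o -> F) (p : C^o) (r M : R) L : 0 < r ->
  hol_disc g p r -> (forall z : C^o, rnorm (z - p) < r -> rnorm (g z) <= M) ->
  cderiv g p L -> forall y : C^o, rnorm (y - p) < r / 8 ->
  rnorm (g y - g p - (y - p) *: L) <= (64 * 64) * M / r ^+ 2 * rnorm (y - p) ^+ 2.
Proof.
move=> r0 gd gM gL y yp.
pose e (z : C^o) := g z - (z - p) *: L.
have -> : g y - g p - (y - p) *: L = e y - e p.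
  by rewrite /e subrr scale0r subr0 addrAC.
rewrite [rnorm _ ^+ 2]expr2 mulrA; apply: cderiv_segment_lipschitz => t /andP[t0 t1].
set z := p + _.
have zp : rnorm (z - p) <= rnorm (y - p).
  rewrite /z addrC addKr (rnormM t%:C (y - p)) rnorm_real ger0_norm //.
  by rewrite ler_piMl ?rnorm_ge0.
have zr : rnorm (z - p) < r / 8 by exact: le_lt_trans zp yp.
have r1 : r / 8 < r by lra.
have [Lz gz] := gd z (lt_trans zr r1).
exists (Lz - L).
  apply: cderivB => // eps eps0; exists 1 => // w _.
  have -> : (w - p) *: L - (z - p) *: L - (w - z) *: L = 0.
    rewrite -!scalerBl (_ : w - p - (z - p) - (w - z) = 0) ?scale0r //; ring.
  by rewrite rnorm0 mulr_ge0 ?rnorm_ge0 // ltW.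
have pp : rnorm (p - p) < r / 8 by rewrite subrr rnorm0 divr_gt0.
apply: le_trans (hol_disc_deriv_lipschitz r0 gd gM pp zr gL gz) _.
rewrite ler_wpM2l // divr_ge0 ?exprn_ge0 ?(ltW r0) // mulr_ge0 //.
by have := gM p; rewrite subrr rnorm0 => /(_ r0); apply: le_trans; exact: rnorm_ge0.
Qed.

Lemma cvg_rnormP E (u : nat -> E) (l : E) :
  u n @[n --> \oo] --> l <->
  forall e : R, 0 < e -> exists N, forall n, (N <= n)%N -> rnorm (u n - l) < e.
Proof.
split=> [ul e e0|ul A /nbhs_rnormP[e e0 eA]].
  have : nbhs l [set y | rnorm (y - l) < e] by apply/nbhs_rnormP; exists e.
  by move=> /ul[N _ NP]; exists N => n /NP.
by have [N NP] := ul _ e0; exists N => // n /NP /eA.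
Qed.

Lemma cvg_rnorm_le E (u : nat -> E) (l : E) (b : R) :
  u n @[n --> \oo] --> l -> (forall n, rnorm (u n) <= b) -> rnorm l <= b.
Proof.
move=> /cvg_rnormP ul ub; apply/ler_addgt0Pr => e /ul[N /(_ N (leqnn N)) h].
have := rnorm_subD (u N) l 0; rewrite !subr0 [rnorm (l - _)]rnormBC.
by have := ub N; lra.
Qed.

Definition rcomplete E : Prop := forall u : nat -> E,
  (forall e : R, 0 < e -> exists N, forall m n, (N <= m)%N -> (N <= n)%N ->
     rnorm (u m - u n) <= e) -> exists l : E, u n @[n --> \oo] --> l.

(** The second order bound is uniform in the index, so the derivatives at [p] differ from difference
    quotients at a fixed step by a uniformly small amount. These quotients converge, hence the
    derivatives are Cauchy, and the bound passes to the limit. *)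
Lemma hol_disc_limit F (g_ : nat -> C^o -> F) (g : C^o -> F) (p : C^o) (r M : R) :
  rcomplete F -> 0 < r ->
  (forall n, hol_disc (g_ n) p r) ->
  (forall n (z : C^o), rnorm (z - p) < r -> rnorm (g_ n z) <= M) ->
  (forall z : C^o, rnorm (z - p) < r -> g_ n z @[n --> \oo] --> g z) ->
  exists L, cderiv g p L.
Proof.
move=> Fc r0 gd gM gcv.
have pp : rnorm (p - p) < r by rewrite subrr rnorm0.
have /choice[L_ L_P] : forall n, exists L, cderiv (g_ n) p L by move=> n; exact: gd.
have sec n := hol_disc_second_order r0 (gd n) (gM n) (L_P n).
set K := (64 * 64) * M / r ^+ 2 in sec.
have M0 : 0 <= M by apply: le_trans (gM 0%N p pp); exact: rnorm_ge0.
have K0 : 0 <= K by rewrite divr_ge0 ?exprn_ge0 ?(ltW r0) // mulr_ge0.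
have [L LP] : exists L : F, L_ n @[n --> \oo] --> L.
  apply: Fc => e e0.
  have K10 : 0 < K + 1 by rewrite ltr_wpDl.
  (* This step makes the Taylor remainder at most [e / 4 * d]; once it is fixed, convergence is
     needed only at the two points [p] and [p + h]. *)
  pose d := Num.min (r / 16) (e / 4 / (K + 1)).
  have d0 : 0 < d by rewrite lt_min !divr_gt0.
  pose h : C^o := d%:C.
  have hE : rnorm h = d by rewrite rnorm_real ger0_norm // ltW.
  have hr : rnorm (p + h - p) < r / 8.
    rewrite (_ : p + h - p = h); last by ring.
    by rewrite hE gt_min; apply/orP; left; lra.
  have hr' : rnorm (p + h - p) < r by lra.
  have ed0 : 0 < e / 8 * d by rewrite mulr_gt0 // divr_gt0.
  have [N1 N1P] := (cvg_rnormP _ _).1 (gcv (p + h) hr') _ ed0.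
  have [N2 N2P] := (cvg_rnormP _ _).1 (gcv p pp) _ ed0.
  have Kd : K * d <= e / 4.
    have : d * (K + 1) <= e / 4 by rewrite -ler_pdivlMr // ge_min lexx orbT.
    by rewrite mulrDr mulr1 mulrC; lra.
  pose D n := g_ n (p + h) - g_ n p.
  have secn n : rnorm (D n - h *: L_ n) <= e / 4 * d.
    have := sec n (p + h) hr; rewrite (_ : p + h - p = h); last by ring.
    rewrite hE expr2 mulrA => b; apply: le_trans b _.
    by rewrite ler_wpM2r // ltW.
  exists (maxn N1 N2) => m n; rewrite !geq_max => /andP[m1 m2] /andP[n1 n2].
  have DD : rnorm (D m - D n) <= e / 2 * d.
    have -> : D m - D n = (g_ m (p + h) - g (p + h)) - (g_ n (p + h) - g (p + h))
        - ((g_ m p - g p) - (g_ n p - g p)).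
      rewrite /D !opprD !opprK !addrA.
      by rewrite [RHS](AC 8 (1*5*3*7*(2*4)*(6*8)))/= !(addNr, subrr) !addr0.
    have := N1P m m1; have := N1P n n1; have := N2P m m2; have := N2P n n2.
    have -> : e / 2 * d = e / 8 * d + e / 8 * d + (e / 8 * d + e / 8 * d) by field.
    move=> a1 a2 a3 a4.
    apply: le_trans (rnormB _ _) (lerD _ _);
    by apply: le_trans (rnormB _ _) (lerD _ _); exact: ltW.
  have hL : rnorm (h *: (L_ m - L_ n)) <= e * d.
    have -> : h *: (L_ m - L_ n) =
      (D n - h *: L_ n) - (D m - h *: L_ m) + (D m - D n).
      move: (D m) (D n) => u v; rewrite scalerBr !opprD !opprK !addrA.
      by rewrite [RHS](AC 6 (4*2*(1*6)*(3*5)))/= addNr subrr !addr0.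
    apply: le_trans (rnormD _ _) _; have := rnormB (D n - h *: L_ n) (D m - h *: L_ m).
    have := secn n; have := secn m.
    have -> : e * d = e / 4 * d + e / 4 * d + e / 2 * d by field.
    by move: DD; move: (e / 4 * d) (e / 2 * d) => *; lra.
  by move: hL; rewrite rnormZ hE mulrC ler_pM2r.
exists L => e e0.
have K10 : 0 < K + 1 by rewrite ltr_wpDl.
exists (Num.min (r / 8) (e / (K + 1))); first by rewrite lt_min !divr_gt0.
move=> y; rewrite lt_min => /andP[yr ye].
have yr' : rnorm (y - p) < r by lra.
apply: (@le_trans _ _ (K * rnorm (y - p) ^+ 2)).
  apply: (@cvg_rnorm_le _ (fun n => g_ n y - g_ n p - (y - p) *: L_ n)) => [|n]; last exact: sec.
  apply: cvgB; first by apply: cvgB; exact: gcv.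
  by apply: cvgZl_tmp.
rewrite [rnorm _ ^+ 2]expr2 mulrA ler_wpM2r ?rnorm_ge0 //.
move: ye; rewrite ltr_pdivlMr // mulrDr mulr1 mulrC => ye.
by have := rnorm_ge0 (y - p); lra.
Qed.

(** * Several variables, by restriction to complex lines *)

Lemma differentiable_line E F (g : E -> F) (x v : E) (z : C^o) :
  differentiable g (x + z *: v) -> exists L, cderiv (fun z : C^o => g (x + z *: v)) z L.
Proof.
move=> gd; apply/differentiable_cderivP.
apply: (@differentiable_comp _ C^o E F (fun z : C^o => x + z *: v) g) => //.
Qed.

Definition hol_ball E F (g : E -> F) (a : E) (r : R) : Prop :=
  forall x, rnorm (x - a) < r -> differentiable g x.

(** On the complex line through [x] and [y], the ball contains discs of radius [r / 2 / N] about the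
    points of the segment, to which the one-variable Cauchy estimate applies. *)
Lemma hol_ball_lipschitz E F (g : E -> F) (a : E) (r M : R) : 0 < r ->
  hol_ball g a r -> (forall x, rnorm (x - a) < r -> rnorm (g x) <= M) ->
  forall x y, rnorm (x - a) < r / 2 -> rnorm (y - a) < r / 2 ->
  rnorm (g y - g x) <= 32 * M / r * rnorm (y - x).
Proof.
move=> r0 gd gM x y xa ya.
have [->|yx] := eqVneq y x; first by rewrite !subrr !rnorm0 mulr0.
pose v := y - x; pose N := rnorm v.
have N0 : 0 < N by rewrite rnorm_gt0 // subr_eq0.
pose phi (z : C^o) := g (x + z *: v).
have -> : g y = phi 1 by rewrite /phi scale1r addrC subrK.
have -> : g x = phi 0 by rewrite /phi scale0r addr0.
rewrite -[rnorm (y - x)]/N.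
have -> : 32 * M / r * N = 32 * M / r * N * rnorm ((1 : C^o) - 0).
  by rewrite subr0 rnorm1 mulr1.
apply: cderiv_segment_lipschitz => t /andP[t0 t1].
rewrite add0r subr0 mulr1.
have ta : rnorm (x + t%:C *: v - a) < r / 2.
  have -> : x + t%:C *: v - a = (1 - t)%:C *: (x - a) + t%:C *: (y - a).
    have -> : y - a = v + (x - a) by rewrite /v addrA subrK.
    rewrite addrAC; move: (x - a) => w.
    by rewrite [_ *: (v + w)]scalerDr [_ *: v + _]addrC addrA -scalerDl -rmorphD subrK rmorph1 scale1r.
  apply: le_lt_trans (rnormD _ _) _; rewrite !rnormZ !rnorm_real !ger0_norm ?subr_ge0 //.
  move: (rnorm (x - a)) (rnorm (y - a)) xa ya => b c br cr.
  have mr : Num.max b c < r / 2 by rewrite gt_max br cr.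
  have hb : (1 - t) * b <= (1 - t) * Num.max b c.
    by rewrite ler_wpM2l ?subr_ge0 // le_max lexx.
  have hc : t * c <= t * Num.max b c by rewrite ler_wpM2l // le_max lexx orbT.
  by move: (Num.max b c) mr hb hc => m *; lra.
have in_ball (z : C^o) : rnorm (z - t%:C) < r / 2 / N -> rnorm (x + z *: v - a) < r.
  rewrite ltr_pdivlMr // => zt.
  have -> : x + z *: v - a = (x + t%:C *: v - a) + (z - t%:C) *: v.
    rewrite [(z - _) *: v]scalerBl addrA [RHS](AC 5 (1*4*3*(2*5)))/=.
    by rewrite subrr addr0.
  by apply: le_lt_trans (rnormD _ _) _; rewrite rnormZ; lra.
have rN : 0 < r / 2 / N by rewrite !divr_gt0.
have phid : hol_disc phi t%:C (r / 2 / N).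
  by move=> z /in_ball/gd; exact: differentiable_line.
have [L gL] : exists L, cderiv phi t%:C L by apply: phid; rewrite subrr rnorm0.
exists L => //.
have -> : 32 * M / r * N = 16 * M / (r / 2 / N) by field; rewrite !gt_eqF.
apply: (cauchy_estimate rN phid _ gL) => z /in_ball; exact: gM.
Qed.

(** One-variable bound, taken at the parameter 1, for the slice [z |-> g (z *: x)], holomorphic on a
    disc of radius [r / rnorm x]. *)
Lemma hol_ball_second_order E F (g : E -> F) (r M : R) : 0 < r ->
  hol_ball g 0 r -> (forall x, rnorm x < r -> rnorm (g x) <= M) ->
  g 0 = 0 ->
  (forall e : R, 0 < e -> exists2 d : R, 0 < d & forall x, rnorm x < d ->
     rnorm (g x) <= e * rnorm x) ->
  forall x, rnorm x < r / 8 -> rnorm (g x) <= 64 * 64 * M / r ^+ 2 * rnorm x ^+ 2.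
Proof.
move=> r0 gd gM g0 g'0 x xr.
have [->|x0] := eqVneq x 0; first by rewrite g0 !rnorm0 expr0n /= mulr0.
have N0 : 0 < rnorm x by rewrite rnorm_gt0.
pose phi (z : C^o) := g (0 + z *: x).
have in_ball (z : C^o) : rnorm (z - 0) < r / rnorm x -> rnorm (0 + z *: x) < r.
  by rewrite subr0 add0r rnormZ ltr_pdivlMr.
have phid : hol_disc phi 0 (r / rnorm x).
  by move=> z /in_ball zr; apply: differentiable_line; apply: gd; rewrite subr0.
have phi0 : cderiv phi 0 0.
  move=> e e0; have eN0 : 0 < e / rnorm x by rewrite divr_gt0.
  have [d d0 dP] := g'0 _ eN0; exists (d / rnorm x); first by rewrite divr_gt0.
  move=> z; rewrite !subr0 scaler0 subr0 ltr_pdivlMr // => zd.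
  rewrite /phi add0r scale0r addr0 g0 subr0.
  have := dP (z *: x); rewrite rnormZ => /(_ zd) h; apply: le_trans h _.
  by rewrite mulrCA divfK ?gt_eqF // mulrC.
have rN : 0 < r / rnorm x by rewrite divr_gt0.
have := hol_disc_second_order rN phid _ phi0 (y := 1).
rewrite !subr0 rnorm1 scaler0 /phi subr0 scale1r !add0r scale0r g0 subr0.
move=> /(_ M) h; apply: le_trans (h _ _) _.
- by move=> z /in_ball; exact: gM.
- by rewrite mulrAC ltr_pdivlMr // mul1r.
- rewrite expr1n mulr1 le_eqVlt; apply/orP; left; apply/eqP.
  by move: (64 * 64 * M) => K; field; rewrite !gt_eqF.
Qed.

(** * Completeness of the model space *)

Lemma rcomplete_complex : rcomplete C^o.
Proof.
move=> u uc.
have cvR (v : nat -> R) : (forall m n, `|v m - v n| <= rnorm (u m - u n)) ->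
    exists l : R, v n @[n --> \oo] --> l.
  move=> vu; exists (lim (v n @[n --> \oo])).
  apply: (@cauchy_cvg R (v n @[n --> \oo])).
  apply: cauchy_exP => e e0; have e20 : 0 < e / 2 by rewrite divr_gt0.
  have [N NP] := uc _ e20.
  exists (v N); exists N => // n /= Nn; rewrite /ball /=.
  by apply: le_lt_trans (vu _ _) _; have := NP N n (leqnn N) Nn; lra.
have [a aP] := cvR (fun n => complex.Re (u n)) (fun m n =>
  eq_ind _ (fun x : R => `|x| <= rnorm (u m - u n)) (rnorm_Re (u m - u n)) _
   (eq_trans (ReD _ _) (congr1 _ (ReN _)))).
have [b bP] := cvR (fun n => complex.Im (u n)) (fun m n =>
  eq_ind _ (fun x : R => `|x| <= rnorm (u m - u n)) (rnorm_Im (u m - u n)) _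
   (eq_trans (ImD _ _) (congr1 _ (ImN _)))).
exists (a +i* b)%C; apply/cvg_rnormP => e e0.
have e20 : 0 < e / 2 by rewrite divr_gt0.
have /cvgrPdist_lt/(_ _ e20)[N1 _ N1P] := aP.
have /cvgrPdist_lt/(_ _ e20)[N2 _ N2P] := bP.
exists (maxn N1 N2) => n; rewrite geq_max => /andP[n1 n2].
apply: le_lt_trans (rnorm_ReIm _) _; rewrite !reimE /=.
have := N1P n n1; have := N2P n n2; rewrite /= distrC [in X in _ -> X]distrC.
by move: `|_ - _| `|_ - _| => *; lra.
Qed.

Lemma rnorm_coord m (x : 'rV[C]_m) j : rnorm (x ord0 j : C^o) <= rnorm x.
Proof.
rewrite -lecR -!rnormE [leRHS]mx_normE.
rewrite -[leLHS]nngE num_le; apply: (le_bigmax _ _ (ord0, j)).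
Qed.

Lemma rnorm_coord_le m (x : 'rV[C]_m) (e : R) : 0 <= e ->
  (forall j, rnorm (x ord0 j : C^o) <= e) -> rnorm x <= e.
Proof.
move=> e0 xe; have [->|x0] := eqVneq x 0; first by rewrite rnorm0.
have [|[i j] /= xE] := @mx_norm_neq0 _ _ _ x.
  by apply: contra x0 => /eqP/mx_norm_eq0 ->.
have -> : rnorm x = rnorm (x i j : C^o) by rewrite /rnorm -xE.
by rewrite (ord1 i).
Qed.

Lemma rcomplete_rV m : rcomplete 'rV[C]_m.
Proof.
move=> u uc.
have /choice[l lP] : forall j, exists l : C^o, u n ord0 j @[n --> \oo] --> l.
  move=> j; apply: rcomplete_complex => e /uc[N NP]; exists N => p q pN qN.
  by apply: le_trans (NP p q pN qN); have := rnorm_coord (u p - u q) j; rewrite !mxE.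
exists (\row_j l j); apply/cvg_rnormP => e e0.
have e20 : 0 < e / 2 by rewrite divr_gt0.
have /choice[N NP] : forall j, exists N, forall n, (N <= n)%N ->
    rnorm (u n ord0 j - l j : C^o) < e / 2.
  by move=> j; have /cvg_rnormP := lP j; exact.
exists (\sum_j N j) => n nN.
apply: (@le_lt_trans _ _ (e / 2)); last by lra.
apply: rnorm_coord_le => [|j]; first exact: ltW.
rewrite !mxE; apply: ltW; apply: NP; apply: leq_trans nN.
by rewrite (bigD1 j) //= leq_addr.
Qed.

End Limits.

(** * Holomorphic maps into a complex Lie group *)

Section LieGroup.
Context {R : realType} {n : nat} {G : complexLieGroupType R n}.
Local Notation C := (R[i]).
Local Notation E := ('rV[C]_n : normedModType C).
Implicit Types V W : normedModType C.
Local Notation atlasG := (@atlas R n G).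

Lemma differentiable_near V W (f g : V -> W) (x : V) :
  (\forall y \near x, f y = g y) -> differentiable f x -> differentiable g x.
Proof.
move=> fg /differentiable_rnormP[L Lc fL]; apply/differentiable_rnormP; exists L => //.
move=> e /fL[d d0 dP]; have gx := nbhs_singleton fg.
move/nbhs_rnormP : fg => [d' d'0 fg].
exists (Num.min d d'); first by rewrite lt_min d0.
by move=> y; rewrite lt_min => /andP[/dP h /fg <-]; rewrite -gx.
Qed.

Lemma atlas_chart (c : chart E G) : atlasG c -> is_chart c.
Proof. by move=> cA; have [+ _ _] := @atlasP R n G; apply. Qed.

Lemma chart_around (x : G) : exists2 c : chart E G, atlasG c & chart_dom c x.
Proof. by have [_ + _] := @atlasP R n G; apply. Qed.

Lemma chart_dom_nbhs (c : chart E G) (x : G) : atlasG c -> chart_dom c x ->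
  nbhs x (chart_dom c).
Proof. by move=> /atlas_chart[cO _ _ _ _] xc; apply: open_nbhs_nbhs. Qed.

Lemma chart_invK (c : chart E G) (x : G) : atlasG c -> chart_dom c x ->
  chart_inv c (chart_map c x) = x.
Proof. by move=> /atlas_chart[_ _ + _ _]; apply. Qed.

Lemma chart_map_cts (c : chart E G) (x : G) : atlasG c -> chart_dom c x ->
  {for x, continuous (chart_map c)}.
Proof.
move=> /atlas_chart[cO _ _ cc _] xc; move: cc.
by rewrite continuous_open_subspace // => /(_ x); rewrite inE; apply.
Qed.

Lemma chart_inv_cts (c : chart E G) (y : E) : atlasG c -> chart_img c y ->
  {for y, continuous (chart_inv c)}.
Proof.
move=> /atlas_chart[_ cO _ _ cc] yc; move: cc.
by rewrite continuous_open_subspace // => /(_ y); rewrite inE; apply.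
Qed.

(** Pointwise holomorphy on a vector space, with charts on the target only; [V] is general so that
    one notion serves [C^o], [E] and [E * E]. *)
Definition hol_at V (f : V -> G) (z : V) : Prop :=
  {for z, continuous f} /\
  forall c, atlasG c -> chart_dom c (f z) -> differentiable (chart_map c \o f) z.

Lemma entireP (f : C^o -> G) :
  holomorphic_map (model_atlas C^o) atlasG f <-> forall z, hol_at f z.
Proof.
split=> [[fc fd] z|fh].
  split=> [|c cA fz]; first exact: fc.
  by apply: (fd (Chart setT id id) c) => //; exists z.
split=> [z|c d -> dA z]; first exact: (fh z).1.
by move=> [w [_ wd] <-]; exact: (fh w).2.
Qed.

Lemma hol_at_near V (f g : V -> G) z :
  (\forall y \near z, f y = g y) -> hol_at f z -> hol_at g z.
Proof.
move=> fg [fc fd]; have fgz := nbhs_singleton fg; split.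
  by rewrite /prop_for /continuous_at -fgz; apply: cvg_trans fc; exact: near_eq_cvg.
move=> c cA gz; rewrite -fgz in gz; apply: differentiable_near (fd c cA gz).
by apply: filterS fg => y /= ->.
Qed.

Lemma hol_at_compr V W (f : V -> G) (h : W -> V) z :
  differentiable h z -> hol_at f (h z) -> hol_at (f \o h) z.
Proof.
move=> hd [fc fd]; split.
  by apply: continuous_comp fc; exact: differentiable_continuous.
move=> c cA fz; rewrite -[_ \o _]/((chart_map c \o f) \o h).
by apply: differentiable_comp => //; exact: fd.
Qed.

Lemma hol_at_cst V (x : G) (z : V) : hol_at (cst x) z.
Proof. by split=> [|c cA _]; [exact: cst_continuous|exact: (differentiable_cst (chart_map c x))]. Qed.

Lemma hol_at_inv V (f : V -> G) z : hol_at f z -> hol_at (fun y => (f y)^-1%g) z.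
Proof.
move=> [fc fd]; have [ic id] := @holomorphic_invg R n G.
split=> [|c cA fz]; first exact: (continuous_comp fc (ic _)).
have [b bA bfz] := chart_around (f z).
have nb : nbhs z (f @^-1` chart_dom b) by apply: fc; exact: chart_dom_nbhs.
(* Holomorphy of inversion is given only through charts, so a chart [b] around [f z] is inserted; it
   cancels near [z]. *)
pose h := (chart_map c \o (fun x : G => x^-1%g) \o chart_inv b) \o (chart_map b \o f).
apply: (@differentiable_near _ _ h).
  by apply: filterS nb => y yb; rewrite /h /= chart_invK.
apply: differentiable_comp; first exact: fd.
by apply: id => //; exists (f z).
Qed.

Lemma hol_at_mul V (f g : V -> G) z :
  hol_at f z -> hol_at g z -> hol_at (fun y => (f y * g y)%g) z.
Proof.
move=> [fc fd] [gc gd]; have [mc md] := @holomorphic_mulg R n G.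
split=> [|c cA fgz].
  apply: (@continuous_comp _ _ _ (fun y => (f y, g y)) (fun p : G * G => (p.1 * p.2)%g)); last exact: mc.
  exact: cvg_pair.
have [a aA afz] := chart_around (f z); have [b bA bgz] := chart_around (g z).
have na : nbhs z (f @^-1` chart_dom a) by apply: fc; exact: chart_dom_nbhs.
have nb : nbhs z (g @^-1` chart_dom b) by apply: gc; exact: chart_dom_nbhs.
pose h := (chart_map c \o (fun p : G * G => (p.1 * p.2)%g) \o chart_inv (prod_chart a b))
  \o (fun y => (chart_map a (f y), chart_map b (g y))).
apply: (@differentiable_near _ _ h).
  by apply: filterS2 na nb => y ya yb; rewrite /h /= !chart_invK.
apply: differentiable_comp; first by apply: differentiable_pair; [exact: fd|exact: gd].
apply: md => //; first by exists a => //; exists b.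
by exists (f z, g z).
Qed.

(** Read in another chart of the target, this is a transition map of the atlas. *)
Lemma hol_at_chart_inv (c : chart E G) (y : E) :
  atlasG c -> chart_img c y -> hol_at (chart_inv c) y.
Proof.
move=> cA cy; split; first exact: chart_inv_cts.
move=> d dA dy; have [_ _ trans] := @atlasP R n G.
apply: (trans c d cA dA); move: cy => [x xc xy].
by exists x => //; split => //; rewrite -xy chart_invK in dy.
Qed.

(* A chart at the identity, translated so as to be centred at 0; [liota] and
   [lpsi] are meaningful only on the ball of radius [lrad] and on [ldom]. *)
Record local_chart := LocalChart {
  lpsi : G -> E; liota : E -> G; lrad : R; ldom : set G;
  lrad_gt0 : 0 < lrad;
  liota0 : liota 0 = 1%g;
  ldom_nbhs : forall x, ldom x -> nbhs x ldom;
  lpsiK : forall x, ldom x -> liota (lpsi x) = x;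
  liotaK : forall y, rnorm y < lrad -> lpsi (liota y) = y;
  ldom_iota : forall y, rnorm y < lrad -> ldom (liota y);
  liota_hol : forall y, rnorm y < lrad -> hol_at liota y;
  lpsi_cts : forall x, ldom x -> {for x, continuous lpsi};
  lpsi_hol : forall V (f : V -> G) z, hol_at f z -> ldom (f z) ->
    differentiable (lpsi \o f) z }.

Lemma local_chart_exists : inhabited local_chart.
Proof.
have [c cA c1] := chart_around 1%g.
pose y0 := chart_map c 1%g.
have [_ imgO _ _ _] := atlas_chart cA.
have img1 : chart_img c y0 by exists 1%g.
have /nbhs_rnormP[r r0 rP] : nbhs y0 (chart_img c) by apply: open_nbhs_nbhs.
pose psi x := chart_map c x - y0; pose iota y := chart_inv c (y + y0).
have img y : rnorm y < r -> chart_img c (y + y0).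
  by move=> yr; apply: rP; rewrite addrK.
have imgK y : chart_img c y -> chart_dom c (chart_inv c y) /\ chart_map c (chart_inv c y) = y.
  by move=> [x xc <-]; rewrite chart_invK.
refine (inhabits (@LocalChart psi iota r (chart_dom c) r0 _ _ _ _ _ _ _ _)).
- by rewrite /iota add0r chart_invK.
- by move=> x; exact: chart_dom_nbhs.
- by move=> x xc; rewrite /iota /psi subrK chart_invK.
- by move=> y /img/imgK[_ h]; rewrite /psi /iota h addrK.
- by move=> y /img/imgK[].
- move=> y /img yi; apply: (@hol_at_compr _ _ (chart_inv c) (fun y => y + y0)).
    by apply: differentiableD.
  exact: hol_at_chart_inv.
- move=> x xc; apply: cvgB; [exact: chart_map_cts|exact: cvg_cst].
- move=> V f z [fc fd] fz; rewrite -[_ \o _]/(fun y => (chart_map c \o f) y - cst y0 y).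
  by apply: differentiableB => //; exact: fd.
Qed.

End LieGroup.

(** * Koenigs linearisation *)

Section Koenigs.
Context {R : realType}.
Local Notation C := (R[i]).
Variable (E : normedModType C).

Definition half (x : E) : E := (2^-1 : C) *: x.

Lemma rnorm_half x : rnorm (half x) = rnorm x / 2.
Proof.
rewrite /half rnormZ rnormV -[2 in LHS](rmorph_nat (real_complex R)) rnorm_real.
by rewrite ger0_norm // mulrC.
Qed.

Lemma half_double x : (2 : C) *: half x = x.
Proof. by rewrite /half scalerA divff ?scale1r // pnatr_eq0. Qed.

Lemma differentiable_cvg (F : normedModType C) (f : E -> F) (u : nat -> E) (x : E) :
  differentiable f x -> u k @[k --> \oo] --> x -> f (u k) @[k --> \oo] --> f x.
Proof. by move=> /differentiable_continuous fc ux; exact: (cvg_comp _ _ ux fc). Qed.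

Variables (s : E -> E) (r K : R).
Hypotheses (Ec : rcomplete E) (r0 : 0 < r) (K0 : 0 <= K).
Hypothesis sd : forall x, rnorm x < r -> differentiable s x.
Hypothesis s2 : forall x, rnorm x < r -> rnorm (s x - (2 : C) *: x) <= K * rnorm x ^+ 2.
Hypothesis s3 : forall x y, rnorm x < r -> rnorm y < r ->
  rnorm (s y - s x) <= 3 * rnorm (y - x).

(** Halving inside and applying [s] outside expresses stage [k + 1] at [x] through stage [k] at
    [half x], which is how the estimates propagate. *)
Fixpoint koenigs_seq k (x : E) : E :=
  if k is k'.+1 then s (koenigs_seq k' (half x)) else x.

(** Below this radius [4 * K * rnorm x ^+ 2 <= rnorm x < r / 2], so a point that close to [x] stays
    in the ball of radius [r]. *)
Let delta := Num.min (r / 2) (4 * K + 1)^-1.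

Let delta_gt0 : 0 < delta.
Proof. by rewrite lt_min divr_gt0 //= invr_gt0 ltr_wpDl // mulr_ge0. Qed.

Let small (x y : E) : rnorm x < delta -> rnorm (y - x) <= 4 * K * rnorm x ^+ 2 -> rnorm y < r.
Proof.
rewrite lt_min => /andP[xr xK] yx.
have K1 : 0 < 4 * K + 1 by rewrite ltr_wpDl // mulr_ge0.
have h : 4 * K * rnorm x ^+ 2 <= rnorm x.
  rewrite expr2 mulrA -[leRHS]mul1r ler_wpM2r ?rnorm_ge0 //.
  move: xK; rewrite -[(4 * K + 1)^-1]mul1r ltr_pdivlMr // mulrDr mulr1 mulrC.
  by have := rnorm_ge0 x; lra.
by have := rnormD (y - x) x; rewrite subrK; lra.
Qed.

Let half_small (x : E) : rnorm x < delta -> rnorm (half x) < delta.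
Proof. by rewrite rnorm_half; have := rnorm_ge0 x; lra. Qed.

(** An increment picks up 3 from the Lipschitz bound [s3] and 1/4 from squaring a halved norm,
    whence the ratio 3/4. Both bounds need one induction: the first, a partial geometric sum of the
    second, keeps the iterates where [s3] applies. *)
Lemma koenigs_step k x : rnorm x < delta ->
  rnorm (koenigs_seq k x - x) <= 4 * K * (1 - (3 / 4) ^+ k) * rnorm x ^+ 2 /\
  rnorm (koenigs_seq k.+1 x - koenigs_seq k x) <= K * (3 / 4) ^+ k * rnorm x ^+ 2.
Proof.
have weaken j (y : E) : 4 * K * (1 - (3 / 4) ^+ j) * rnorm y ^+ 2 <= 4 * K * rnorm y ^+ 2.
  have q1 : 1 - (3 / 4) ^+ j <= 1 :> R by rewrite gerBl exprn_ge0 // divr_ge0.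
  by rewrite ler_wpM2r ?sqr_ge0 // ler_piMr ?mulr_ge0.
have sq_half (y : E) : rnorm (half y) ^+ 2 = rnorm y ^+ 2 / 4.
  by rewrite rnorm_half; field.
have bound j (y : E) : rnorm y < delta ->
    rnorm (koenigs_seq j y - y) <= 4 * K * (1 - (3 / 4) ^+ j) * rnorm y ^+ 2 ->
    rnorm (koenigs_seq j y) < r.
  by move=> yd h; apply: small yd _; exact: le_trans h (weaken _ _).
elim: k x => [|k ih] x xd.
  rewrite /= expr0 !subrr rnorm0 mulr0 mul0r mulr1; split=> //.
  have xr : rnorm (half x) < r.
    apply: (small (half_small xd)); rewrite subrr rnorm0.
    by rewrite mulr_ge0 ?sqr_ge0 // mulr_ge0.
  have := s2 xr; rewrite half_double sq_half => h; apply: le_trans h _.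
  by rewrite ler_wpM2l // ler_pdivrMr // ler_peMr ?sqr_ge0 // ler1n.
have [h1 h2] := ih x xd.
have first_part (y : E) : rnorm y < delta ->
    rnorm (koenigs_seq k.+1 y - y) <= 4 * K * (1 - (3 / 4) ^+ k.+1) * rnorm y ^+ 2.
  move=> yd; have [g1 g2] := ih y yd.
  have := rnorm_subD (koenigs_seq k y) (koenigs_seq k.+1 y) y.
  have -> : 4 * K * (1 - (3 / 4) ^+ k.+1) * rnorm y ^+ 2 =
     K * (3 / 4) ^+ k * rnorm y ^+ 2 + 4 * K * (1 - (3 / 4) ^+ k) * rnorm y ^+ 2.
    by rewrite exprS; field.
  by move=> h; apply: le_trans h _; exact: lerD.
split; first exact: first_part.
have hd := half_small xd; have [g1 g2] := ih _ hd.
have b1 := bound _ _ hd g1; have b2 := bound k.+1 _ hd (first_part _ hd).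
apply: le_trans (s3 b1 b2) _.
apply: (@le_trans _ _ (3 * (K * (3 / 4) ^+ k * rnorm (half x) ^+ 2))).
  by rewrite ler_wpM2l.
by rewrite sq_half [(3 / 4) ^+ k.+1]exprS le_eqVlt; apply/orP; left; apply/eqP; field.
Qed.

Lemma koenigs_seq_close k x : rnorm x < delta ->
  rnorm (koenigs_seq k x - x) <= 4 * K * rnorm x ^+ 2.
Proof.
move=> /(koenigs_step k)[h _]; apply: le_trans h _.
have q1 : 1 - (3 / 4) ^+ k <= 1 :> R by rewrite gerBl exprn_ge0 // divr_ge0.
by rewrite ler_wpM2r ?sqr_ge0 // ler_piMr ?mulr_ge0.
Qed.

Lemma koenigs_seq_small k x : rnorm x < delta -> rnorm (koenigs_seq k x) < r.
Proof. by move=> xd; apply: (small xd); exact: koenigs_seq_close. Qed.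

Lemma geometric_small (q c e : R) : 0 <= q < 1 -> 0 <= c -> 0 < e ->
  exists N, forall m, (N <= m)%N -> c * q ^+ m <= e.
Proof.
move=> /andP[q0 q1] c0 e0.
have : (fun m => c * q ^+ m) @ \oo --> c * 0.
  by apply: cvgMl_tmp; apply: cvg_expr; rewrite ger0_norm.
rewrite mulr0 => /cvgrPdist_lt/(_ _ e0)[N _ NP]; exists N => m /NP /=.
by rewrite sub0r normrN => /ltW; apply: le_trans; exact: ler_norm.
Qed.

(** The factor [1 - q] makes the increments telescope to [c * (q ^+ j - q ^+ k)]. *)
Lemma geometric_cauchy (u : nat -> E) (c q : R) : 0 <= q < 1 -> 0 <= c ->
  (forall k, rnorm (u k.+1 - u k) <= c * (1 - q) * q ^+ k) ->
  (forall j k, (j <= k)%N -> rnorm (u k - u j) <= c * q ^+ j) /\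
  exists l : E, u k @[k --> \oo] --> l.
Proof.
move=> q01 c0 uc; have /andP[q0 q1] := q01.
have tele j k : (j <= k)%N -> rnorm (u k - u j) <= c * (q ^+ j - q ^+ k).
  move=> /subnK <-; elim: (k - j)%N => [|m ih].
    by rewrite add0n !subrr rnorm0 mulr0.
  rewrite addSn; apply: le_trans (rnorm_subD (u (m + j)%N) _ _) _.
  have -> : c * (q ^+ j - q ^+ (m + j).+1) =
    c * (1 - q) * q ^+ (m + j) + c * (q ^+ j - q ^+ (m + j)) by rewrite exprS; ring.
  exact: lerD.
have tele' j k : (j <= k)%N -> rnorm (u k - u j) <= c * q ^+ j.
  move=> /tele h; apply: le_trans h _; rewrite ler_wpM2l // gerBl exprn_ge0 //.
split=> //; apply: Ec => e e0.
have [N NP] := geometric_small q01 c0 (divr_gt0 e0 (ltr0n R 2 : 0 < 2%:R)).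
exists N => m k mN kN.
have hN : c * q ^+ N <= e / 2 by exact: NP.
have h1 := tele' _ _ mN; have h2 := tele' _ _ kN.
have := rnorm_subD (u N) (u m) (u k); rewrite [rnorm (u N - u k)]rnormBC.
by move: hN h1 h2; move: (c * q ^+ N) => t; lra.
Qed.

Lemma koenigs_cvg (x : E) : rnorm x < delta ->
  exists l : E, koenigs_seq k x @[k --> \oo] --> l.
Proof.
move=> xd; have q01 : 0 <= (3 / 4 : R) < 1 by apply/andP; split; lra.
have c0 : 0 <= 4 * K * rnorm x ^+ 2 by rewrite mulr_ge0 ?sqr_ge0 // mulr_ge0.
apply: (geometric_cauchy q01 c0 _).2 => k.
have [_ h] := koenigs_step k xd; apply: le_trans h _.
by rewrite le_eqVlt; apply/orP; left; apply/eqP; field.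
Qed.

Lemma koenigs_seq_differentiable k x : rnorm x < delta ->
  differentiable (koenigs_seq k) x.
Proof.
elim: k x => [|k ih] x xd; first by apply: (@ex_diff _ _ _ _ _ id id).
apply: (@differentiable_comp _ _ _ _ (koenigs_seq k \o half) s).
  apply: differentiable_comp; last by apply: ih; exact: half_small.
  exact: differentiableZ.
by apply: sd; apply: koenigs_seq_small; exact: half_small.
Qed.

(* Koenigs' linearisation of a map [s] with [s x = 2 x + O(|x|^2)]:
   [Phi = lim s^k (x / 2^k)] conjugates doubling to [s]. *)
Theorem koenigs_linearization : exists2 d : R, 0 < d & exists Phi : E -> E,
  [/\ forall x, rnorm x < d -> rnorm (Phi x) < r,
      forall x, rnorm x < d -> rnorm (Phi x - x) <= 4 * K * rnorm x ^+ 2,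
      forall x, rnorm x < d -> Phi x = s (Phi (half x)) &
      forall (v : E) (z : C^o), rnorm ((z : C) *: v) < d ->
        exists L, cderiv (fun z : C^o => Phi ((z : C) *: v)) z L].
Proof.
exists delta => //.
(* A total function is chosen; 0 is a default outside the ball. *)
have /choice[Phi PhiP] : forall x, exists l : E, rnorm x < delta ->
    koenigs_seq k x @[k --> \oo] --> l.
  move=> x; have [/koenigs_cvg[l lP]|] := boolP (rnorm x < delta); first by exists l.
  by move=> _; exists 0.
have close x : rnorm x < delta -> rnorm (Phi x - x) <= 4 * K * rnorm x ^+ 2.
  move=> xd; apply: (@cvg_rnorm_le _ _ (fun k => koenigs_seq k x - x)).
    by apply: cvgB; [exact: PhiP|exact: cvg_cst].
  by move=> k; exact: koenigs_seq_close.
have Phir x : rnorm x < delta -> rnorm (Phi x) < r.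
  by move=> xd; apply: (small xd); exact: close.
exists Phi; split=> // [x xd|v z zd].
  have h1 : koenigs_seq k.+1 x @[k --> \oo] --> Phi x.
    by have := PhiP x xd; rewrite -(cvg_shiftS (fun k => koenigs_seq k x)).
  have h2 : koenigs_seq k.+1 x @[k --> \oo] --> s (Phi (half x)).
    apply: (@differentiable_cvg _ s); first by apply: sd; apply: Phir; exact: half_small.
    by apply: PhiP; exact: half_small.
  exact: (cvg_unique (@norm_hausdorff _ _) h1 h2).
pose N := rnorm v + 1; have N0 : 0 < N by rewrite ltr_wpDl ?rnorm_ge0.
pose rho := (delta - rnorm ((z : C) *: v)) / N.
have rho0 : 0 < rho by rewrite divr_gt0 // subr_gt0.
have near_small (w : C^o) : rnorm (w - z) < rho -> rnorm ((w : C) *: v) < delta.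
  rewrite ltr_pdivlMr // => wz.
  have := rnormD ((w - z : C) *: v) ((z : C) *: v); rewrite -scalerDl subrK rnormZ.
  have : rnorm (w - z) * rnorm v <= rnorm (w - z) * N.
    by apply: ler_wpM2l; rewrite ?rnorm_ge0 // lerDl ler01.
  by move: (rnorm (w - z) * N) wz => *; lra.
apply: (@hol_disc_limit _ _ (fun k (w : C^o) => koenigs_seq k ((w : C) *: v)) _ _ rho r) => //.
- move=> k w /near_small wd.
  have := @differentiable_line _ _ _ (koenigs_seq k) 0 v w; rewrite add0r.
  move=> /(_ (koenigs_seq_differentiable k wd))[L gL]; exists L.
  by move: gL; congr cderiv; apply/funext => y; rewrite add0r.
- by move=> k w /near_small wd; apply: ltW; exact: koenigs_seq_small.
- by move=> w /near_small; exact: PhiP.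
Qed.

End Koenigs.

(** * The group law in a chart at the identity *)

Section LocalGroup.
Context {R : realType} {n : nat} {G : complexLieGroupType R n}.
Local Notation C := (R[i]).
Local Notation E := ('rV[C]_n : normedModType C).
Local Notation EE := ((E * E)%type : normedModType C).
Variable lc : @local_chart R n G.
Local Notation psi := (lpsi lc).
Local Notation iota := (liota lc).
Local Notation rho := (lrad lc).

Lemma rnorm_pair (V W : normedModType C) (x : V) (y : W) :
  rnorm ((x, y) : (V * W)%type) = Num.max (rnorm x) (rnorm y).
Proof.
suff : (rnorm ((x, y) : (V * W)%type))%:C = (Num.max (rnorm x) (rnorm y))%:C by case.
by rewrite -rnormE prod_normE /= !rnormE !maxEle lecR; case: ifP.
Qed.

Lemma lpsi1 : psi 1%g = 0.
Proof. by rewrite -(liota0 lc) liotaK // rnorm0 lrad_gt0. Qed.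

Lemma ldom1 : ldom lc 1%g.
Proof. by rewrite -(liota0 lc); apply: ldom_iota; rewrite rnorm0 lrad_gt0. Qed.

(** Shared by product and quotient: continuity at 0 bounds the operation in the chart by 1, and the
    Lipschitz bound on half the radius follows from Cauchy's estimate. *)
Lemma chart_op_bounds (op : EE -> G) :
  (forall p : EE, rnorm p < rho -> hol_at op p) -> op 0 = 1%g ->
  exists2 r : R, 0 < r <= rho & exists2 c : R, 0 <= c &
  (forall p : EE, rnorm p < r ->
     [/\ ldom lc (op p), differentiable (psi \o op) p & rnorm (psi (op p)) <= 1]) /\
  (forall p q : EE, rnorm p < r -> rnorm q < r ->
     rnorm (psi (op q) - psi (op p)) <= c * rnorm (q - p)).
Proof.
move=> oph op0; have rho0 := lrad_gt0 lc.
have oph0 : hol_at op 0 by apply: oph; rewrite rnorm0.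
have dom0 : ldom lc (op 0) by rewrite op0; exact: ldom1.
have /nbhs_rnormP[e1 e10 e1P] : nbhs (0 : EE) (op @^-1` ldom lc).
  by apply: oph0.1; exact: ldom_nbhs.
have /nbhs_rnormP[e2 e20 e2P] : nbhs (0 : EE) ((psi \o op) @^-1` [set y | rnorm y < 1]).
  apply: (differentiable_continuous (lpsi_hol oph0 dom0)) => /=.
  by rewrite op0 lpsi1; apply/nbhs_rnormP; exists 1 => // y; rewrite subr0.
pose r := Num.min (Num.min e1 e2) rho.
have r0 : 0 < r by rewrite !lt_min e10 e20.
have good (p : EE) : rnorm p < r ->
     [/\ ldom lc (op p), differentiable (psi \o op) p & rnorm (psi (op p)) <= 1].
  rewrite !lt_min => /andP[/andP[p1 p2] p3].
  have pd : ldom lc (op p) by apply: e1P; rewrite subr0.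
  split=> //; first by apply: lpsi_hol => //; exact: oph.
  by apply: ltW; apply: e2P; rewrite subr0.
exists (r / 2).
  rewrite divr_gt0 //=; have : r <= rho by rewrite ge_min lexx orbT.
  lra.
exists (32 * 1 / r); first by rewrite divr_ge0 ?(ltW r0) // mulr_ge0.
split=> [p pr|p q pr qr]; first by apply: good; lra.
have gd : hol_ball (psi \o op) 0 r by move=> x; rewrite subr0 => /good[].
have gM x : rnorm (x - 0) < r -> rnorm ((psi \o op) x) <= 1.
  by rewrite subr0 => /good[].
by have := hol_ball_lipschitz r0 gd gM (x := p) (y := q); rewrite !subr0; apply.
Qed.

Lemma hol_at_fst (p : EE) : rnorm p < rho -> hol_at (fun p : EE => iota p.1) p.
Proof.
case: p => x y; rewrite rnorm_pair gt_max => /andP[xr _].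
apply: (@hol_at_compr _ _ _ _ _ iota (fun p : EE => p.1)); last exact: liota_hol.
apply: linear_differentiable => q; exact: cvg_fst.
Qed.

Lemma hol_at_snd (p : EE) : rnorm p < rho -> hol_at (fun p : EE => iota p.2) p.
Proof.
case: p => x y; rewrite rnorm_pair gt_max => /andP[_ yr].
apply: (@hol_at_compr _ _ _ _ _ iota (fun p : EE => p.2)); last exact: liota_hol.
apply: linear_differentiable => q; exact: cvg_snd.
Qed.

(** Each estimate is a Lipschitz bound against a pair with known value: [(x, 0)] gives [x], and
    [(y, y)] gives the identity. The first controls the infinite product, the second the Newton
    iteration. *)
Lemma local_group_bounds : exists2 r : R, 0 < r <= rho & exists2 c : R, 0 <= c &
  forall x y : E, rnorm x < r -> rnorm y < r ->
  [/\ ldom lc (iota x * iota y)%g, ldom lc ((iota x)^-1 * iota y)%g,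
      rnorm (psi (iota x * iota y)%g - x) <= c * rnorm y &
      rnorm (psi ((iota x)^-1 * iota y)%g) <= c * rnorm (x - y)].
Proof.
have [||r1 /andP[r10 r1r] [c1 c10 [g1 l1]]] :=
  @chart_op_bounds (fun p : EE => (iota p.1 * iota p.2)%g).
- by move=> p pr; apply: hol_at_mul; [exact: hol_at_fst|exact: hol_at_snd].
- by rewrite /= liota0 mulg1.
have [||r2 /andP[r20 r2r] [c2 c20 [g2 l2]]] :=
  @chart_op_bounds (fun p : EE => ((iota p.1)^-1 * iota p.2)%g).
- move=> p pr; apply: hol_at_mul; last exact: hol_at_snd.
  by apply: hol_at_inv; exact: hol_at_fst.
- by rewrite /= liota0 invg1 mulg1.
exists (Num.min r1 r2); first by rewrite lt_min r10 r20 ge_min r1r.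
exists (Num.max c1 c2); first by rewrite le_max c10.
move=> x y; rewrite !lt_min => /andP[x1 x2] /andP[y1 y2].
have p1 : rnorm ((x, y) : EE) < r1 by rewrite rnorm_pair gt_max x1 y1.
have p2 : rnorm ((x, y) : EE) < r2 by rewrite rnorm_pair gt_max x2 y2.
split; [by have [] := g1 _ p1|by have [] := g2 _ p2| |].
- have q1 : rnorm ((x, 0) : EE) < r1 by rewrite rnorm_pair gt_max x1 rnorm0 r10.
  have := l1 _ _ q1 p1; rewrite /= liota0 mulg1 liotaK; last by apply: lt_le_trans r1r.
  rewrite (_ : (x, y) - (x, 0) = (0, y) :> EE); last first.
    by congr pair; rewrite /= ?subrr ?subr0.
  rewrite rnorm_pair rnorm0 max_r ?rnorm_ge0 // => h; apply: le_trans h _.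
  by rewrite ler_wpM2r ?rnorm_ge0 // le_max lexx.
- have q2 : rnorm ((y, y) : EE) < r2 by rewrite rnorm_pair gt_max y2.
  have := l2 _ _ q2 p2; rewrite /= mulVg lpsi1 subr0.
  rewrite (_ : (x, y) - (y, y) = (x - y, 0) :> EE); last first.
    by congr pair; rewrite /= ?subrr ?subr0.
  rewrite rnorm_pair rnorm0 max_l ?rnorm_ge0 // => h; apply: le_trans h _.
  by rewrite ler_wpM2r ?rnorm_ge0 // le_max lexx orbT.
Qed.

Definition lsquare (x : E) : E := psi (iota x * iota x)%g.

Lemma rnorm2 (x : E) : rnorm ((2 : C) *: x) = 2 * rnorm x.
Proof.
rewrite rnormZ -[2 in LHS](rmorph_nat (real_complex R)) rnorm_real.
by rewrite ger0_norm.
Qed.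

Lemma lsquare_bounds : exists2 r : R, 0 < r <= rho & exists2 K : R, 0 <= K &
  [/\ forall x, rnorm x < r -> ldom lc (iota x * iota x)%g,
      forall x, rnorm x < r -> differentiable lsquare x,
      forall x, rnorm x < r -> rnorm (lsquare x - (2 : C) *: x) <= K * rnorm x ^+ 2 &
      forall x y, rnorm x < r -> rnorm y < r ->
        rnorm (lsquare y - lsquare x) <= 3 * rnorm (y - x)].
Proof.
pose op (p : EE) := (iota p.1 * iota p.2)%g.
have [||r1 /andP[r10 r1r] [c1 c10 [g1 l1]]] := @chart_op_bounds op.
- by move=> p pr; apply: hol_at_mul; [exact: hol_at_fst|exact: hol_at_snd].
- by rewrite /op /= liota0 mulg1.
have diagE (x : E) : rnorm ((x, x) : EE) = rnorm x by rewrite rnorm_pair maxxx.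
have sd (x : E) : rnorm x < r1 -> differentiable lsquare x.
  move=> xr; apply: (@differentiable_comp _ _ _ _ (fun x : E => (x, x) : EE) (psi \o op)).
    by apply: differentiable_pair; apply: (@ex_diff _ _ _ _ _ id id).
  by have [|] := g1 (x, x); rewrite ?diagE.
pose t (x : E) := lsquare x - (2 : C) *: x.
have td (x : E) : rnorm x < r1 -> differentiable t x.
  by move=> xr; apply: differentiableB; [exact: sd|exact: differentiableZ].
have tM (x : E) : rnorm x < r1 -> rnorm (t x) <= 1 + 2 * r1.
  move=> xr; apply: le_trans (rnormB _ _) _; rewrite rnorm2.
  have [|_ _ h] := g1 (x, x); first by rewrite diagE.
  by apply: lerD => //; rewrite ler_wpM2l // ltW.
have t0 : t 0 = 0 by rewrite /t /lsquare liota0 mulg1 lpsi1 scaler0 subr0.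
(* Setting one argument to 0 shows that the differential [L] of multiplication is close to the
   identity on each factor; by additivity [L (x, x)] is close to [2 x]. *)
have t'0 (e : R) : 0 < e -> exists2 d : R, 0 < d & forall x, rnorm x < d ->
     rnorm (t x) <= e * rnorm x.
  move=> e0; have [|_ /differentiable_rnormP[L _ dL] _] := g1 0; first by rewrite rnorm0.
  have e30 : 0 < e / 3 by rewrite divr_gt0.
  have [d d0 dP] := dL _ e30; exists (Num.min d r1); first by rewrite lt_min d0.
  move=> x; rewrite lt_min => /andP[xd xr].
  have xrho : rnorm x < rho by apply: lt_le_trans r1r.
  have op0 : psi (op 0) = 0 by rewrite /op /= liota0 mulg1 lpsi1.
  have {}dP (y : EE) : rnorm y < d -> rnorm (psi (op y) - L y) <= e / 3 * rnorm y.
    by have := dP y; rewrite /= op0 !subr0.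
  have h1 := dP (x, 0); have h2 := dP (0, x); have h3 := dP (x, x).
  rewrite /op /= liota0 mulg1 liotaK // rnorm_pair rnorm0 max_l ?rnorm_ge0 // in h1.
  rewrite /op /= liota0 mul1g liotaK // rnorm_pair rnorm0 max_r ?rnorm_ge0 // in h2.
  rewrite -/(lsquare x) diagE in h3.
  have LE : L (x, x) = L (x, 0) + L (0, x).
    by rewrite -raddfD; congr (L _); congr pair; rewrite /= ?addr0 ?add0r.
  have -> : t x = (lsquare x - L (x, x)) - (x - L (x, 0)) - (x - L (0, x)).
    rewrite /t LE scaler_nat mulr2n !opprD !opprK !addrA.
    by rewrite [RHS](AC 7 (1*4*6*(2*5)*(3*7)))/= !addNr !addr0.
  have -> : e * rnorm x = e / 3 * rnorm x + e / 3 * rnorm x + e / 3 * rnorm x by field.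
  apply: le_trans (rnormB _ _) (lerD (le_trans (rnormB _ _) (lerD _ _)) _).
  - exact: h3.
  - exact: h1.
  - exact: h2.
have tball : hol_ball t 0 r1 by move=> x; rewrite subr0; exact: td.
have t2 := hol_ball_second_order r10 tball tM t0 t'0.
set K := (64 * 64 * (1 + 2 * r1) / r1 ^+ 2) in t2.
have K0 : 0 <= K.
  by rewrite divr_ge0 ?exprn_ge0 ?(ltW r10) // mulr_ge0 // addr_ge0 // mulr_ge0 // ltW.
(* On the ball of radius [r2] the map [t] is at most [K * r2 ^+ 2], hence Lipschitz with constant
   [32 * K * r2 <= 1] on half of it. With the linear part this gives the Lipschitz constant 3, below
   the 4 gained by halving. *)
pose r2 := Num.min (r1 / 8) (32 * K + 1)^-1.
have K1 : 0 < 32 * K + 1 by rewrite ltr_wpDl // mulr_ge0.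
have r20 : 0 < r2 by rewrite lt_min invr_gt0 K1 divr_gt0.
have r2r1 : r2 <= r1 / 8 by rewrite ge_min lexx.
have r2_lt_r1 : r2 < r1 by lra.
have r2_half x : x < r2 / 2 -> x < r1 /\ x < r1 / 8 by split; lra.
have r2K : 32 * K * r2 <= 1.
  have : r2 <= (32 * K + 1)^-1 by rewrite ge_min lexx orbT.
  rewrite -[(32 * K + 1)^-1]mul1r ler_pdivlMr // mulrDr mulr1 mulrC; lra.
have t3 (x y : E) : rnorm x < r2 / 2 -> rnorm y < r2 / 2 ->
    rnorm (t y - t x) <= rnorm (y - x).
  move=> xr yr; have := @hol_ball_lipschitz _ _ _ t 0 r2 (K * r2 ^+ 2) r20.
  move=> /(_ _ _ x y); rewrite !subr0 => h; apply: le_trans (h _ _ xr yr) _.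
  - by move=> z; rewrite subr0 => zr; apply: td; exact: lt_trans r2_lt_r1.
  - move=> z; rewrite subr0 => zr; apply: le_trans (t2 z (lt_le_trans zr r2r1)) _.
    apply: ler_wpM2l => //; rewrite lerXn2r ?nnegrE ?rnorm_ge0 //; last exact: ltW.
    exact: ltW.
  - have -> : 32 * (K * r2 ^+ 2) / r2 = 32 * K * r2 by field; rewrite gt_eqF.
    by rewrite -[leRHS]mul1r ler_wpM2r ?rnorm_ge0.
exists (r2 / 2); first by apply/andP; split; [rewrite divr_gt0|lra].
exists K => //; split=> [x xr|x xr|x xr|x y xr yr].
- by have [|] := g1 (x, x); rewrite ?diagE //; exact: (r2_half _ xr).1.
- exact: sd (r2_half _ xr).1.
- exact: t2 (r2_half _ xr).2.
- have -> : lsquare y - lsquare x = (t y - t x) + (2 : C) *: (y - x).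
    rewrite /t scalerBr !opprD !opprK !addrA.
    by rewrite [RHS](AC 6 (1*3*(2*5)*(4*6)))/= addNr subrr !addr0.
  have -> : 3 * rnorm (y - x) = rnorm (y - x) + 2 * rnorm (y - x) by ring.
  by apply: le_trans (rnormD _ _) (lerD (t3 _ _ xr yr) _); rewrite rnorm2.
Qed.

(* [Phi] is the exponential map of [G] read in the chart: only
   [exp (2 x) = exp x ^ 2], its holomorphy along lines and its first order
   behaviour at 0 are needed. *)
Lemma local_exponential : exists2 d : R, 0 < d & exists2 K : R, 0 <= K &
  exists Phi : E -> E,
  [/\ forall x, rnorm x < d -> rnorm (Phi x) < rho,
      forall x, rnorm x < d -> rnorm (Phi x - x) <= K * rnorm x ^+ 2,
      forall x, rnorm x < d ->
        iota (Phi x) = (iota (Phi (half x)) * iota (Phi (half x)))%g &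
      forall (v : E) (z : C^o), rnorm ((z : C) *: v) < d ->
        hol_at (fun z : C^o => iota (Phi ((z : C) *: v))) z].
Proof.
have [r /andP[r0 rr] [K K0 [s1 sd s2 s3]]] := lsquare_bounds.
have [d d0 [Phi [P1 P2 P3 P4]]] :=
  koenigs_linearization (@rcomplete_rV R n) r0 K0 sd s2 s3.
exists d => //; exists (4 * K); first by rewrite mulr_ge0.
exists Phi; split=> // [x xd|x xd|v z zd].
- by apply: lt_le_trans rr; exact: P1.
- rewrite P3 // lpsiK //; apply: s1; apply: P1.
  by rewrite rnorm_half; have := rnorm_ge0 x; lra.
- have [L /(ex_intro _ L)/differentiable_cderivP gL] := P4 v z zd.
  apply: (@hol_at_compr _ _ _ _ _ iota (fun z : C^o => Phi ((z : C) *: v))) => //.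
  by apply: liota_hol; apply: lt_le_trans rr; exact: P1.
Qed.

End LocalGroup.

(** * Entire curves and density of their values *)

Section EntireCurves.
Context {R : realType} {n : nat} {G : complexLieGroupType R n}.
Local Notation C := (R[i]).
Local Notation E := ('rV[C]_n : normedModType C).

Lemma mulg_cts (x y : G) : {for (x, y), continuous (fun p : G * G => (p.1 * p.2)%g)}.
Proof. by have [mc _] := @holomorphic_mulg R n G; exact: mc. Qed.

Lemma lmulg_cts (x : G) : continuous (fun y : G => (x * y)%g).
Proof.
move=> y; apply: (@continuous_comp _ _ _ (fun y => (x, y)) (fun p : G * G => (p.1 * p.2)%g)).
  by apply: cvg_pair; [exact: cvg_cst|exact: cvg_id].
exact: mulg_cts.
Qed.

Lemma iter_half k (z : C) (v : E) : iter k (@half R E) (z *: v) = z *: iter k (@half R E) v.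
Proof.
by elim: k => //= k ->; rewrite /half !scalerA mulrC.
Qed.

Lemma rnorm_iter_half k (v : E) : rnorm (iter k (@half R E) v) = rnorm v / 2 ^+ k.
Proof.
elim: k => [|k ih]; first by rewrite expr0 divr1.
by rewrite iterS rnorm_half ih exprSr invfM mulrA.
Qed.

Lemma hol_at_iter_sqr (V : normedModType C) k (f : V -> G) z :
  hol_at f z -> hol_at (fun w => iter k (fun g : G => (g * g)%g) (f w)) z.
Proof. by elim: k => //= k ih /ih h; apply: hol_at_mul. Qed.

(* Since [exp x = (exp (x / 2^k))^(2^k)], the local exponential determines
   entire curves. *)
Lemma one_parameter_curve (lc : @local_chart R n G) (d : R) (Phi : E -> E) (v : E) :
  0 < d -> Phi 0 = 0 ->
  (forall x, rnorm x < d -> liota lc (Phi x) =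
     (liota lc (Phi (half x)) * liota lc (Phi (half x)))%g) ->
  (forall (v : E) (z : C^o), rnorm ((z : C) *: v) < d ->
        hol_at (fun z : C^o => liota lc (Phi ((z : C) *: v))) z) ->
  exists f : C^o -> G, [/\ forall z, hol_at f z, f 0 = 1%g &
    rnorm v < d -> f 1 = liota lc (Phi v)].
Proof.
move=> d0 Phi0 PhiS Phih.
pose sq (g : G) := (g * g)%g.
(* Stage [k] of the exponential of [x], meaningful for [rnorm x < 2 ^+ k * d]; any two stages agree
   where both are. *)
pose expc k x := iter k sq (liota lc (Phi (iter k (@half R E) x))).
have two0 k : 0 < 2 ^+ k :> R by rewrite exprn_gt0.
have expcS k x : rnorm x < 2 ^+ k * d -> expc k.+1 x = expc k x.
  move=> xk; rewrite /expc iterSr; congr (iter k sq _).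
  by rewrite [RHS]PhiS // rnorm_iter_half ltr_pdivrMr // mulrC.
have expc_le k j x : (k <= j)%N -> rnorm x < 2 ^+ k * d -> expc j x = expc k x.
  move=> kj xk; move: kj => /subnK <-; elim: (j - k)%N => // m <-.
  rewrite addSn expcS //; apply: lt_le_trans xk _.
  by rewrite ler_pM2r // ler_weXn2l ?ler1n // leq_addl.
have expc_eq k j x : rnorm x < 2 ^+ k * d -> rnorm x < 2 ^+ j * d -> expc j x = expc k x.
  by move=> xk xj; have [kj|/ltnW jk] := leqP k j; [exact: expc_le|rewrite (expc_le j k)].
have /choice[K KP] : forall z : C^o, exists k, rnorm ((z : C) *: v) < 2 ^+ k * d.
  move=> z; exists (Num.bound (rnorm ((z : C) *: v) / d)).
  rewrite -ltr_pdivrMr //.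
  have h0 : 0 <= rnorm ((z : C) *: v) / d by rewrite divr_ge0 ?rnorm_ge0 // ltW.
  rewrite (lt_le_trans (archi_boundP h0)) //.
  by rewrite -natrX ler_nat ltnW // ltn_expl.
pose f z := expc (K z) ((z : C) *: v).
exists f; split=> [z||vd].
- have N0 : 0 < rnorm v + 1 by rewrite ltr_wpDl ?rnorm_ge0.
  (* The index [K] is an arbitrary choice with no continuity, but near [z] the stage [K z] can be
     frozen by [expc_eq]. *)
  apply: (@hol_at_near _ _ _ _ (fun w : C^o => expc (K z) ((w : C) *: v))).
    apply/nbhs_rnormP; exists ((2 ^+ K z * d - rnorm ((z : C) *: v)) / (rnorm v + 1)).
      by rewrite divr_gt0 // subr_gt0.
    move=> w; rewrite ltr_pdivlMr // => wz; rewrite /f; apply: expc_eq => //.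
    have := rnormD ((w - z : C) *: v) ((z : C) *: v); rewrite -scalerDl subrK rnormZ.
    have : rnorm (w - z) * rnorm v <= rnorm (w - z) * (rnorm v + 1).
      by apply: ler_wpM2l; rewrite ?rnorm_ge0 // lerDl ler01.
    by move: (rnorm (w - z) * (rnorm v + 1)) (2 ^+ K z * d) wz => *; lra.
  apply: hol_at_iter_sqr.
  have := Phih (iter (K z) (@half R E) v) z.
  rewrite -iter_half rnorm_iter_half ltr_pdivrMr // [d * _]mulrC => /(_ (KP z)).
  by congr (hol_at _ _); apply/funext => w; rewrite iter_half.
- have half0 k : iter k (@half R E) 0 = 0.
    by have := iter_half k 0 0; rewrite !scale0r.
  rewrite /f /expc scale0r half0 Phi0 liota0.
  by elim: (K _) => //= k ->; rewrite /sq mulg1.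
- rewrite /f scale1r (expc_eq 0%N) //; first by rewrite expr0 mul1r.
  by have := KP 1; rewrite scale1r.
Qed.

(** The normalisation [F 0 = 1] lets [perturbation] damp [F] on a disc by composing it with a high
    power of the variable, and it survives products. *)
Definition entire_value (g : G) : Prop :=
  exists F : C^o -> G, [/\ forall z, hol_at F z, F 0 = 1%g & F 1 = g].

Lemma entire_valueM g h : entire_value g -> entire_value h -> entire_value (g * h)%g.
Proof.
move=> [F [Fh F0 F1]] [H [Hh H0 H1]]; exists (fun z => (F z * H z)%g); split.
- by move=> z; apply: hol_at_mul.
- by rewrite F0 H0 mulg1.
- by rewrite F1 H1.
Qed.

Lemma entire_value1 : entire_value 1%g.
Proof. by exists (cst 1%g); split => // z; exact: hol_at_cst. Qed.

(* Newton-like iteration: for [r] small, [iota r = iota (Phi r) * iota r'] with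
   [r'] quadratically small, so that [iota r] is a limit of products of values
   of one-parameter curves. *)
Lemma near1_closure_entire (lc : @local_chart R n G) :
  exists2 d : R, 0 < d <= lrad lc & forall y : E, rnorm y < d ->
    closure [set g : G | entire_value g] (liota lc y).
Proof.
have [d1 d10 [K K0 [Phi [P1 P2 P3 P4]]]] := local_exponential lc.
have [r /andP[r0 rr] [c c0 bnd]] := local_group_bounds lc.
have Phi0 : Phi 0 = 0.
  have := P2 0; rewrite rnorm0 expr0n mulr0 subr0 => /(_ d10).
  exact: rnorm_le0.
(* [D] dominates both [K] and [c * K], so [rnorm y * D < 1 / 2] makes [Phi y - y] and the next
   remainder at most half of [rnorm y]. *)
pose D := c * K + K + 1.
have D0 : 0 < D by rewrite ltr_wpDl // addr_ge0 // mulr_ge0.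
pose d := Num.min (Num.min d1 (r / 2)) (D^-1 / 2).
have d0 : 0 < d by rewrite !lt_min d10 !divr_gt0 // invr_gt0.
have dr : d <= r / 2 by rewrite /d !ge_min lexx orbT.
exists d; first by apply/andP; split => //; lra.
have step (y : E) : rnorm y < d ->
  [/\ entire_value (liota lc (Phi y)),
      liota lc (lpsi lc ((liota lc (Phi y))^-1 * liota lc y)%g) =
        ((liota lc (Phi y))^-1 * liota lc y)%g &
      rnorm (lpsi lc ((liota lc (Phi y))^-1 * liota lc y)%g) <= rnorm y / 2].
  rewrite !lt_min => /andP[/andP[yd1 yr] yD].
  have hK := P2 y yd1.
  have sm : rnorm y * D < 1 / 2.
    by rewrite -ltr_pdivlMr // mul1r mulrC.
  have smK : K * rnorm y ^+ 2 <= rnorm y / 2 /\ c * (K * rnorm y ^+ 2) <= rnorm y / 2.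
    have y0 := rnorm_ge0 y.
    have cK : 0 <= c * K by rewrite mulr_ge0.
    have a1 : rnorm y * K <= rnorm y * D by apply: ler_wpM2l => //; rewrite /D; lra.
    have a2 : rnorm y * (c * K) <= rnorm y * D by apply: ler_wpM2l => //; rewrite /D; lra.
    split.
      have -> : K * rnorm y ^+ 2 = rnorm y * (rnorm y * K) by ring.
      by apply: ler_wpM2l => //; lra.
    have -> : c * (K * rnorm y ^+ 2) = rnorm y * (rnorm y * (c * K)) by ring.
    by apply: ler_wpM2l => //; lra.
  have yr' : rnorm y < r by lra.
  have Pr : rnorm (Phi y) < r.
    by have := rnormD (Phi y - y) y; rewrite subrK; have := smK.1; lra.
  have [_ dom _ q] := bnd (Phi y) y Pr yr'.
  split.
  - have [f [fh f0 f1]] := one_parameter_curve y d10 Phi0 P3 P4.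
    by exists f; split => //; exact: f1.
  - exact: lpsiK.
  - apply: le_trans q _; apply: le_trans smK.2.
    by rewrite ler_wpM2l.
move=> y yd.
pose next x := lpsi lc ((liota lc (Phi x))^-1 * liota lc x)%g.
pose rs j := iter j next y.
have rsb j : rnorm (rs j) < d /\ rnorm (rs j) <= d * 2^-1 ^+ j.
  elim: j => [|j [ih1 ih2]]; first by rewrite expr0 mulr1 /rs /= ltW.
  have [_ _ h] := step _ ih1; rewrite /rs iterS -/(rs j) /next exprS.
  by split; [have := rnorm_ge0 (rs j); lra|rewrite mulrCA; lra].
have fact j : exists2 h, entire_value h & liota lc y = (h * liota lc (rs j))%g.
  elim: j => [|j [h hv hy]]; first by exists 1%g; [exact: entire_value1|rewrite mul1g].
  have [pv pE _] := step _ (rsb j).1.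
  exists (h * liota lc (Phi (rs j)))%g; first exact: entire_valueM.
  by rewrite hy /rs iterS -/(rs j) /next pE -mulgA mulVKg.
(* Each partial product is [liota lc y] times the inverse of a remainder, so it converges to
   [liota lc y] as the remainder tends to 1. *)
have ct : {for 0, continuous (fun x : E => (liota lc y * (liota lc x)^-1)%g)}.
  have lh : hol_at (liota lc) 0 by apply: liota_hol; rewrite rnorm0 lrad_gt0.
  by have [] := hol_at_mul (hol_at_cst (liota lc y) 0) (hol_at_inv lh).
move=> W Wy.
have /nbhs_rnormP[e e0 eW] : nbhs (0 : E) ((fun x : E => (liota lc y * (liota lc x)^-1)%g) @^-1` W).
  by apply: ct => /=; rewrite liota0 invg1 mulg1.
have h01 : 0 <= (2^-1 : R) < 1 by apply/andP; split; lra.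
have e20 : 0 < e / 2 by rewrite divr_gt0.
have [N NP] := @geometric_small R 2^-1 d (e / 2) h01 (ltW d0) e20.
have [h hv hy] := fact N; exists h; split => //.
have -> : h = (liota lc y * (liota lc (rs N))^-1)%g by rewrite hy mulgK.
by apply: eW; rewrite subr0; have := NP N (leqnn N); have := (rsb N).2; lra.
Qed.

Lemma closure_entire_valueM (x y : G) : closure [set g : G | entire_value g] x ->
  closure [set g : G | entire_value g] y -> closure [set g : G | entire_value g] (x * y)%g.
Proof.
move=> xc yc W Wxy.
have [[A B] /= [Ax By] AB] := mulg_cts Wxy.
have [g [gv Ag]] := xc A Ax; have [h [hv Bh]] := yc B By.
exists (g * h)%g; split; first exact: entire_valueM.
by apply: (AB (g, h)).
Qed.

Lemma entire_values_dense : connected [set: G] ->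
  forall W : set G, open W -> W !=set0 -> exists2 g, entire_value g & W g.
Proof.
move=> Gc W Wo [w Ww]; pose cl := closure [set g : G | entire_value g].
have [lc] := @local_chart_exists R n G.
have [d /andP[d0 dr] dcl] := near1_closure_entire lc.
have clT : cl = setT.
  apply: Gc.
  - by exists 1%g; apply: subset_closure; exact: entire_value1.
  - exists cl; last by rewrite setTI.
    (* Openness at [x]: the left translate by [x] of a chart ball at 1 lies in [cl], which is stable
       under products. *)
    rewrite openE => x xc; rewrite /interior.
    have V1 : nbhs (1%g : G) [set g | ldom lc g /\ rnorm (lpsi lc g) < d].
      have l1 := ldom1 lc; apply: filterI; first exact: ldom_nbhs.
      have : nbhs (lpsi lc 1%g) [set y | rnorm y < d].
        by rewrite lpsi1; apply/nbhs_rnormP; exists d => // y; rewrite subr0.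
      exact: (lpsi_cts l1).
    have : nbhs x [set y | (fun y => x^-1 * y)%g y \in [set g | ldom lc g /\ rnorm (lpsi lc g) < d]].
      under eq_set do rewrite inE.
      by apply: (lmulg_cts (x := x^-1%g) (x0 := x)); rewrite mulVg.
    apply: filterS => y /=; rewrite inE => -[yd yr].
    have -> : y = (x * liota lc (lpsi lc (x^-1 * y)%g))%g by rewrite lpsiK // mulVKg.
    by apply: closure_entire_valueM => //; exact: dcl.
  - by exists cl; [exact: closed_closure|rewrite setTI].
have : cl w by rewrite clT.
by move=> /(_ W (open_nbhs_nbhs (conj Wo Ww)))[g [gv gW]]; exists g.
Qed.

End EntireCurves.

(** * The infinite product *)

Section DenseCurve.
Context {R : realType} {n : nat} {G : complexLieGroupType R n}.
Local Notation C := (R[i]).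
Local Notation E := ('rV[C]_n : normedModType C).

(** The base is enumerated through an injection into the naturals; indices coding no nonempty basic
    set receive the whole group, nonempty because of 1. *)
Lemma countable_pi_base : exists b : nat -> set G,
  (forall k, open (b k) /\ b k !=set0) /\
  forall O : set G, open O -> O !=set0 -> exists k, b k `<=` O.
Proof.
have [B Bc [Bo Bx]] := @manifold_second_countable R n G.
have /countable_injP[code codeI] := Bc.
have codeP U V : B U -> B V -> code U = code V -> U = V.
  by move=> BU BV; apply: codeI; rewrite inE.
pose P k U := [/\ B U, U !=set0 & code U = k].
have /choice[b bP] : forall k, exists U, [/\ open U, U !=set0 & (exists V, P k V) -> P k U].
  move=> k; have [[V [BV V0 kV]]|nV] := pselect (exists V, P k V).
    by exists V; split => //; exact: Bo.
  by exists setT; split => //; [exact: openT|exists 1%g].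
exists b; split=> [k|O Oo [x Ox]]; first by have [] := bP k.
have /Bx[U [BU Ux] UO] : nbhs x O by exact: open_nbhs_nbhs.
exists (code U); have [_ _ /(_ _)[]] := bP (code U).
  by exists U; split => //; exists x.
by move=> BbU _ /codeP -> .
Qed.

Variable lc : @local_chart R n G.
Local Notation psi := (lpsi lc).
Local Notation iota := (liota lc).

(* A small perturbation [f * p] of [f] on the disc of radius [k] which meets
   [O] at [k + 1]: take [p z = F ((z / (k + 1)) ^ N)] for [F] entire, [F 0 = 1]
   and [N] large. *)
Lemma perturbation (f : C^o -> G) (k : nat) (O : set G) (e c : R) :
  connected [set: G] -> open O -> O !=set0 -> 0 < e -> 0 <= c ->
  exists (p : C^o -> G) (e' : R),
  [/\ forall z, hol_at p z,
      forall z : C^o, rnorm z <= k%:R -> ldom lc (p z) /\ rnorm (psi (p z)) <= e,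
      0 < e' <= e / 2 &
      forall y : E, rnorm y <= c * e' -> O (f k.+1%:R * p k.+1%:R * iota y)%g].
Proof.
move=> Gc Oo [w Ow] e0 c0; set z0 : C^o := k.+1%:R.
have rat_z0 : rnorm z0 = k.+1%:R.
  by rewrite /z0 -(rmorph_nat (real_complex R)) rnorm_real ger0_norm.
have z0n : z0 != 0 by rewrite pnatr_eq0.
have [_ [F [Fh F0 <-]] OF] : exists2 g, entire_value g & O (f z0 * g)%g.
  have Wo : open ((fun g => (f z0 * g)%g) @^-1` O).
    by apply: open_comp => // g _; exact: lmulg_cts.
  have [|g gv Og] := entire_values_dense Gc Wo; last by exists g.
  by exists ((f z0)^-1 * w)%g; rewrite /= mulVKg.
have [eta eta0 etaP] : exists2 eta : R, 0 < eta &
    forall w : C^o, rnorm w < eta -> ldom lc (F w) /\ rnorm (psi (F w)) <= e.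
  have d1 : ldom lc (F 0) by rewrite F0; exact: ldom1.
  have /nbhs_rnormP[e1 e10 e1P] : nbhs (0 : C^o) (F @^-1` ldom lc).
    by apply: (Fh 0).1; exact: ldom_nbhs.
  have /nbhs_rnormP[e2 e20 e2P] : nbhs (0 : C^o) ((psi \o F) @^-1` [set y | rnorm y < e]).
    apply: (differentiable_continuous (lpsi_hol (Fh 0) d1)) => /=.
    by rewrite F0 lpsi1; apply/nbhs_rnormP; exists e => // y; rewrite subr0.
  exists (Num.min e1 e2); first by rewrite lt_min e10.
  move=> z; rewrite lt_min => /andP[z1 z2].
  by split; [apply: e1P; rewrite subr0|apply: ltW; apply: e2P; rewrite subr0].
(* On the disc of radius [k] the ratio [z / z0] has norm at most [q < 1], so a high power drives it
   below [eta], while at [z0] it stays equal to 1. *)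
pose q : R := k%:R / k.+1%:R.
have q01 : 0 <= q < 1 by rewrite divr_ge0 // ltr_pdivrMr ?ltr0n // mul1r ltr_nat ltnSn.
have [N NP] := geometric_small q01 (@ler01 R) (divr_gt0 eta0 (ltr0n R 2 : 0 < 2%:R)).
have {NP} := NP N.+1 (leqnSn N); rewrite mul1r => NP.
pose p (z : C^o) := F ((z / z0) ^+ N.+1).
have ph z : hol_at p z.
  apply: (@hol_at_compr _ _ _ _ _ F (fun z : C^o => (z / z0) ^+ N.+1)) => //.
  have dM : differentiable (fun z : C^o => z * z0^-1 : C^o) z.
    by apply: differentiableM => //; exact: differentiable_cst.
  by have := differentiableX N dM; rewrite exprfctE.
have pz0 : p z0 = F 1 by rewrite /p divff // expr1n.
have [e1 e10 e1P] : exists2 e1 : R, 0 < e1 &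
    forall y : E, rnorm y < e1 -> O (f z0 * p z0 * iota y)%g.
  have lh : hol_at iota 0 by apply: liota_hol; rewrite rnorm0 lrad_gt0.
  have /nbhs_rnormP[e1 e10 e1P] : nbhs (0 : E) (iota @^-1` ((fun g => (f z0 * p z0 * g)%g) @^-1` O)).
    apply: lh.1; apply: lmulg_cts; rewrite liota0 mulg1 pz0.
    by apply: open_nbhs_nbhs.
  by exists e1 => // y y1; apply: e1P; rewrite subr0.
have c10 : 0 < c + 1 by rewrite ltr_wpDl.
(* The second bound puts [c * e'] below [e1], the radius within which openness of [O] tolerates a
   further factor. *)
exists p, (Num.min (e / 2) (e1 / (c + 1) / 2)); split=> //.
- move=> z zk; apply: etaP; rewrite rnormX rnormM rnormV rat_z0.
  apply: (@le_lt_trans _ _ (q ^+ N.+1)); last by lra.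
  rewrite lerXn2r ?nnegrE ?divr_ge0 ?rnorm_ge0 //.
  by rewrite ler_wpM2r // invr_ge0.
- by rewrite lt_min !divr_gt0 //= ge_min lexx.
- move=> y yc; apply: e1P; apply: le_lt_trans yc _.
  apply: (@le_lt_trans _ _ (c * (e1 / (c + 1) / 2))).
    by rewrite ler_wpM2l // ge_min lexx orbT.
  have t0 : 0 < e1 / (c + 1) by rewrite divr_gt0.
  have tE : (c + 1) * (e1 / (c + 1)) = e1 by rewrite mulrC divfK // gt_eqF.
  rewrite -[ltRHS]tE; have : 0 <= c * (e1 / (c + 1)) by rewrite mulr_ge0 // ltW.
  by move: (e1 / (c + 1)) t0 => t *; lra.
Qed.

(** Tolerances at least halve, and each factor moves the chart coordinate of a tail by at most [c]
    times its tolerance. The tail from stage [k] on thus stays within [2 * c * e_ k], the margin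
    that [perturbation] reserves around its target. *)
Lemma dense_entire_curve : connected [set: G] ->
  exists f : C^o -> G, (forall z, hol_at f z) /\ dense (range f).
Proof.
move=> Gc; have [b [bO bP]] := countable_pi_base.
have [r /andP[r0 rrho] [c c0 bnd]] := local_group_bounds lc.
(* A state is a stage, the partial product so far and the tolerance for the next factor; a step
   returns the factor and a reduced tolerance. *)
have /choice[nxt nxtP] : forall x : nat * ((C^o -> G) * R), exists y : (C^o -> G) * R,
    0 < x.2.2 -> [/\ forall z, hol_at y.1 z,
      forall z : C^o, rnorm z <= x.1%:R -> ldom lc (y.1 z) /\ rnorm (psi (y.1 z)) <= x.2.2,
      0 < y.2 <= x.2.2 / 2 &
      forall v : E, rnorm v <= 2 * c * y.2 ->
        b x.1 (x.2.1 x.1.+1%:R * y.1 x.1.+1%:R * iota v)%g].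
  move=> [k [f e]] /=.
  have [e0|] := boolP (0 < e); last by exists (f, e).
  have c20 : 0 <= 2 * c by rewrite mulr_ge0.
  by have [p [e' pP]] := perturbation f k Gc (bO k).1 (bO k).2 e0 c20; exists (p, e').
(* This value keeps the chart coordinates of all factors and tails below [r], where
   [local_group_bounds] applies. *)
pose e_init := r / (2 * (2 * c + 1)).
have c21 : 0 < 2 * c + 1 by rewrite ltr_wpDl // mulr_ge0.
have e_init0 : 0 < e_init by rewrite divr_gt0 // mulr_gt0.
have e_init_r : e_init < r /\ 2 * c * e_init < r.
  have eE : (2 * c + 1) * e_init = r / 2 by rewrite /e_init; field; rewrite gt_eqF.
  have : 0 <= c * e_init by rewrite mulr_ge0 // ltW.
  by move: eE; split; lra.
pose st := fix st k : (C^o -> G) * R := if k is j.+1 then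
  (fun z => ((st j).1 z * (nxt (j, st j)).1 z)%g, (nxt (j, st j)).2) else (cst 1%g, e_init).
pose f_ k := (st k).1; pose e_ k := (st k).2; pose p_ k := (nxt (k, st k)).1.
have e_gt0 k : 0 < e_ k.
  by elim: k => // k ih; have [_ _ /andP[]] := nxtP (k, st k) ih.
have f_S k z : f_ k.+1 z = (f_ k z * p_ k z)%g by [].
have p_hol k z : hol_at (p_ k) z by have [+ _ _ _] := nxtP (k, st k) (e_gt0 k); apply.
have p_small k (z : C^o) : rnorm z <= k%:R -> ldom lc (p_ k z) /\ rnorm (psi (p_ k z)) <= e_ k.
  by have [_ + _ _] := nxtP (k, st k) (e_gt0 k); apply.
have e_half k : e_ k.+1 <= e_ k / 2 by have [_ _ /andP[]] := nxtP (k, st k) (e_gt0 k).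
have f_meets k (v : E) : rnorm v <= 2 * c * e_ k.+1 -> b k (f_ k.+1 k.+1%:R * iota v)%g.
  by have [_ _ _] := nxtP (k, st k) (e_gt0 k); apply.
have f_hol k z : hol_at (f_ k) z.
  by elim: k => [|k ih]; [exact: hol_at_cst|exact: (hol_at_mul ih (p_hol k z))].
have e_geo k j : e_ (j + k)%N <= e_ k * 2^-1 ^+ j.
  elim: j => [|j ih]; first by rewrite expr0 mulr1.
  by rewrite addSn exprS; have := e_half (j + k)%N; lra.
have e_le k : e_ k <= e_init.
  by elim: k => // k ih; have := e_half k; have := e_gt0 k; lra.
(* Chart coordinate of the tail [p_k ... p_(k+j-1)], written as a quotient of partial products. *)
pose Q k j z := psi ((f_ k z)^-1 * f_ (j + k)%N z)%g.
have QP k j (z : C^o) : rnorm z <= k%:R ->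
    [/\ ldom lc ((f_ k z)^-1 * f_ (j + k)%N z)%g,
        rnorm (Q k j z) <= 2 * c * e_ k * (1 - 2^-1 ^+ j) &
        rnorm (Q k j.+1 z - Q k j z) <= 2 * c * e_ k * (1 - 2^-1) * 2^-1 ^+ j].
  move=> zk.
  have bound i : rnorm (Q k i z) <= 2 * c * e_ k * (1 - 2^-1 ^+ i) -> rnorm (Q k i z) < r.
    move=> h; apply: (le_lt_trans h); apply: le_lt_trans (e_init_r.2).
    have ck : 0 <= 2 * c * e_ k by rewrite !mulr_ge0 // ltW.
    apply: (@le_trans _ _ (2 * c * e_ k)).
      by rewrite ler_piMr // gerBl exprn_ge0 // invr_ge0.
    by rewrite ler_wpM2l // mulr_ge0.
  have step i : ldom lc ((f_ k z)^-1 * f_ (i + k)%N z)%g -> rnorm (Q k i z) < r ->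
      ldom lc ((f_ k z)^-1 * f_ (i.+1 + k)%N z)%g /\
      rnorm (Q k i.+1 z - Q k i z) <= 2 * c * e_ k * (1 - 2^-1) * 2^-1 ^+ i.
    move=> dom Qr; have [|pd ps] := p_small (i + k)%N z.
      by apply: le_trans zk _; rewrite ler_nat leq_addl.
    have pr : rnorm (psi (p_ (i + k)%N z)) < r.
      by have := e_le (i + k)%N; have := e_init_r.1; lra.
    have [m1 _ m2 _] := bnd _ _ Qr pr.
    have mE : ((f_ k z)^-1 * f_ (i.+1 + k)%N z)%g = (iota (Q k i z) * iota (psi (p_ (i + k)%N z)))%g.
      by rewrite /Q !lpsiK // addSn f_S mulgA.
    rewrite {1}/Q mE; split => //; apply: le_trans m2 _.
    have -> : 2 * c * e_ k * (1 - 2^-1) * 2^-1 ^+ i = c * (e_ k * 2^-1 ^+ i) by field.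
    by rewrite ler_wpM2l //; apply: le_trans ps _; exact: e_geo.
  have main i : ldom lc ((f_ k z)^-1 * f_ (i + k)%N z)%g /\
      rnorm (Q k i z) <= 2 * c * e_ k * (1 - 2^-1 ^+ i).
    elim: i => [|i [ih1 ih2]].
      by rewrite /Q add0n mulVg lpsi1 rnorm0 expr0 subrr mulr0; split => //; exact: ldom1.
    have [s1 s2] := step i ih1 (bound i ih2); split => //.
    have := rnormD (Q k i.+1 z - Q k i z) (Q k i z); rewrite subrK => h.
    apply: le_trans h _.
    have -> : 2 * c * e_ k * (1 - 2^-1 ^+ i.+1) =
      2 * c * e_ k * (1 - 2^-1) * 2^-1 ^+ i + 2 * c * e_ k * (1 - 2^-1 ^+ i).
      by rewrite exprS; ring.
    exact: lerD.
  have [m1 m2] := main j; split => //.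
  by have [] := step j m1 (bound j m2).
have ck0 k : 0 <= 2 * c * e_ k by rewrite !mulr_ge0 // ltW.
have ckr k : 2 * c * e_ k < r.
  by apply: le_lt_trans (e_init_r.2); rewrite ler_wpM2l // mulr_ge0.
have Q_le k j (z : C^o) : rnorm z <= k%:R -> rnorm (Q k j z) <= 2 * c * e_ k.
  move=> /(QP k j)[_ h _]; apply: le_trans h _.
  by rewrite ler_piMr // gerBl exprn_ge0 // invr_ge0.
have h01 : 0 <= (2^-1 : R) < 1 by apply/andP; split; lra.
have /choice[Ql QlP] : forall kz : nat * C^o, exists l : E, rnorm kz.2 <= kz.1%:R ->
    Q kz.1 j kz.2 @[j --> \oo] --> l.
  move=> [k z] /=; have [zk|] := boolP (rnorm z <= k%:R); last by exists 0.
  have [|_ [l lP]] := @geometric_cauchy R E (@rcomplete_rV R n) (fun j => Q k j z) _ _ h01 (ck0 k).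
    by move=> j; have [] := QP k j z zk.
  by exists l.
have Ql_le k (z : C^o) : rnorm z <= k%:R -> rnorm (Ql (k, z)) <= 2 * c * e_ k.
  by move=> zk; apply: (cvg_rnorm_le (QlP (k, z) zk)) => j; exact: Q_le.
have f_cvg k (z : C^o) : rnorm z <= k%:R -> f_ j z @[j --> \oo] --> (f_ k z * iota (Ql (k, z)))%g.
  move=> zk.
  suff h : f_ (j + k)%N z @[j --> \oo] --> (f_ k z * iota (Ql (k, z)))%g.
    move=> A /h[N _ NP]; exists (N + k)%N => // j /= Nj.
    have kj : (k <= j)%N by apply: leq_trans Nj; rewrite leq_addl.
    by have := NP (j - k)%N; rewrite /= subnK // leq_subRL // addnC; apply.
  rewrite [X in X @ \oo --> _](_ : _ = (fun j => (f_ k z * iota (Q k j z))%g)); last first.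
    by apply/funext => j; have [d _ _] := QP k j z zk; rewrite /= /Q lpsiK // mulVKg.
  apply: (cvg_comp (fun j => iota (Q k j z)) (fun g => (f_ k z * g)%g)); last exact: lmulg_cts.
  apply: (cvg_comp (fun j => Q k j z) iota); first exact: (QlP (k, z) zk).
  have Qr : rnorm (Ql (k, z)) < lrad lc.
    by apply: lt_le_trans rrho; apply: le_lt_trans (ckr k); exact: Ql_le.
  exact: (liota_hol Qr).1.
have bnd_nat (z : C^o) : rnorm z < (Num.bound (rnorm z))%:R.
  by apply: archi_boundP; exact: rnorm_ge0.
(* An index large enough for [z] is picked; uniqueness of limits in the Hausdorff group makes the
   value independent of it. *)
pose f z := (f_ (Num.bound (rnorm z)) z * iota (Ql (Num.bound (rnorm z), z)))%g.
have fE k (z : C^o) : rnorm z <= k%:R -> f z = (f_ k z * iota (Ql (k, z)))%g.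
  move=> zk; apply: (cvg_unique (@manifold_hausdorff R n G) _ (f_cvg k z zk)).
  by apply: f_cvg; exact: ltW.
exists f; split=> [z|O O0 Oo].
- pose k := Num.bound (rnorm z).
  have kz : 0 < k%:R - rnorm z by rewrite subr_gt0 bnd_nat.
  have in_disc (w : C^o) : rnorm (w - z) < k%:R - rnorm z -> rnorm w <= k%:R.
    by have := rnormD (w - z) z; rewrite subrK => h h'; apply: ltW; lra.
  (* With [k] frozen near [z], the tail coordinate is a bounded pointwise limit of holomorphic maps,
     so [hol_disc_limit] applies. *)
  apply: (@hol_at_near _ _ _ _ (fun w : C^o => (f_ k w * iota (Ql (k, w)))%g)).
    by apply/nbhs_rnormP; exists (k%:R - rnorm z) => // w /in_disc/fE ->.
  apply: hol_at_mul; first exact: f_hol.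
  apply: (@hol_at_compr _ _ _ _ _ iota (fun w : C^o => Ql (k, w))); last first.
    apply: liota_hol; apply: lt_le_trans rrho; apply: le_lt_trans (ckr k).
    by apply: Ql_le; exact: ltW.
  apply/differentiable_cderivP.
  apply: (@hol_disc_limit R E (fun j w => Q k j w) _ z (k%:R - rnorm z) (2 * c * e_ k)) => //.
  + exact: rcomplete_rV.
  + move=> j w /in_disc wk; apply/differentiable_cderivP.
    have [d _ _] := QP k j w wk.
    apply: (@lpsi_hol _ _ _ lc _ (fun w : C^o => ((f_ k w)^-1 * f_ (j + k)%N w)%g)) => //.
    by apply: hol_at_mul; [exact: hol_at_inv|exact: f_hol].
  + by move=> j w /in_disc wk; exact: Q_le.
  + by move=> w /in_disc wk; exact: (QlP (k, w)).
(* The point [k + 1] lies in the disc of radius [k + 1], so the tail after stage [k + 1] is within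
   the margin of [f_meets] and [f] itself lands in [b k]. *)
- have [k kO] := bP O Oo O0.
  have nk : rnorm (k.+1%:R : C^o) <= k.+1%:R.
    by rewrite -(rmorph_nat (real_complex R)) rnorm_real ger0_norm.
  exists (f k.+1%:R); split; last by exists k.+1%:R.
  by apply: kO; rewrite (fE _ _ nk); apply: f_meets; exact: Ql_le.
Qed.

End DenseCurve.

Theorem theorem1p3 (R : realType) (n : nat) (G : complexLieGroupType R n) :
  connected [set: G] ->
  exists f : R[i]^o -> G,
    holomorphic_map (model_atlas R[i]^o) (@atlas R n G) f /\
    dense (range f).
Proof.
move=> Gc; have [lc] := @local_chart_exists R n G.
have [f [fh fd]] := dense_entire_curve lc Gc.
by exists f; split => //; apply/entireP.
Qed.
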